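(* Let $\Gamma$ be a finitely generated abelian group. The class of ultrasimplicial $\Gamma$-groups and the class of countable dimension $\Gamma$-groups coincide.
   Context: Ordered groups. $\mathbb Z^+[\Gamma]\subseteq\mathbb Z[\Gamma]$ is the set of elements with all coefficients nonnegative. An ordered $\Gamma$-group is a left $\mathbb Z[\Gamma]$-module $G$ with a partial order such that $g_1\ge g_2$ implies $g_1+h\ge g_2+h$ and $\gamma g_1\ge\gamma g_2$ for $\gamma\in\Gamma$; $G^+=\{x\ge0\}$. $G$ is directed if any two elements have a common upper bound. $\mathrm{Stab}(G)=\{\gamma\in\Gamma:\gamma x=x\ \forall x\in G\}$. An order-unit is $u\in G^+$ such that for every $x\in G$ there is a nonzero $a\in\mathbb Z^+[\Gamma]$ with $x\le au$. A generating interval is a subset $D\subseteq G^+$ containing $0$ which is upwards directed, convex ($x\le z\le y$, $x,y\in D$ implies $z\in D$), and such that every element of $G^+$ is a finite sum of elements $ad$, $a\in\mathbb Z^+[\Gamma]$, $d\in D$. $[0,u]=\{x:0\le x\le u\}$. $\mathbf{OG}^u_\Gamma$: pairs $(G,u)$, $G$ ordered, $u$ an order-unit, with order-preserving $\mathbb Z[\Gamma]$-homomorphisms taking order-unit to order-unit. $\mathbf{OG}^D_\Gamma$: pairs $(G,D)$, $D$ a generating interval, with order-preserving $\mathbb Z[\Gamma]$-homomorphisms $f:(G,D)\to(H,E)$ with $f(D)\subseteq E$. For a subgroup $\Delta$, $\mathbb Z[\Gamma/\Delta]$ is the permutation module on cosets with cone $\mathbb Z^+[\Gamma/\Delta]$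 and $\pi:\mathbb Z[\Gamma]\to\mathbb Z[\Gamma/\Delta]$ is the left module map $1\mapsto\Delta$. A finite set $X=\{x_1,\dots,x_n\}$ in a $\Gamma$-group (left $\mathbb Z[\Gamma]$-module) $G$ is a simplicial $\Gamma$-basis stabilized by $\Delta$ if each $x_i$ has stabilizer $\Delta$ and, for all $a_i,b_i\in\mathbb Z[\Gamma]$ with $\pi(a_i),\pi(b_i)\in\mathbb Z^+[\Gamma/\Delta]$, $\sum a_ix_i=\sum b_ix_i$ iff $a_i-b_i\in\ker\pi$ for all $i$; its cone is $\{\sum a_ix_i:\pi(a_i)\in\mathbb Z^+[\Gamma/\Delta]\}$. A simplicial $\Gamma$-group is a $\Gamma$-group ordered by, and directed under, the cone of such a finite simplicial $\Gamma$-basis, or the zero group (with basis $\varnothing$, which counts as stabilized by any subgroup). An ordered and directed $\Gamma$-group $G$ is an ultrasimplicial $\Gamma$-group if for some order-unit $u$ (resp. for some generating interval $D$) of $G$, $(G,u)$ (resp. $(G,D)$) is a direct limit in $\mathbf{OG}^u_\Gamma$ (resp. $\mathbf{OG}^D_\Gamma$) of a sequence of simplicial $\Gamma$-groups $(G_n,u_n)$ (resp. $(G_n,[0,u_n])$, $u_n$ an order-unit of $G_n$) with simplicial $\Gamma$-bases all stabilized by the same subgroup of $\Gamma$. (SDP$_\Delta$): if $\sum_{i=1}^n a_ix_i=0$ with $a_i\in\mathbb Z[\Gamma]$, $x_i\in G^+$, then there are a positive integer $m$, $b_{ij}\in\mathbb Z^+[\Gamma]$, $y_j\in G^+$ with $x_i=\sum_{j=1}^m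 b_{ij}y_j$ for all $i$ and $\sum_{i=1}^n\pi(a_ib_{ij})=0$ for all $j$. A dimension $\Gamma$-group is a directed ordered $\Gamma$-group satisfying (SDP$_\Delta$) for some subgroup $\Delta\subseteq\mathrm{Stab}(G)$. *)

(* Defs.v *)
From HB Require Import structures.
From mathcomp Require Import all_boot all_order all_algebra.
From mathcomp Require Import classical_sets cardinality.
From mathcomp Require Import finmap.
From mathcomp Require Import monalg.

Set Implicit Arguments.
Unset Strict Implicit.
Unset Printing Implicit Defensive.

Import Order.TTheory GRing.Theory Num.Theory.
Local Open Scope ring_scope.

(* Bilinear extension of [op] to finitely supported integer combinations. *)
Section Conv.
Variables (S T U : choiceType) (op : S -> T -> U).
Implicit Types (a : {malg int[S]}) (b : {malg int[T]}).

Definition conv a b : {malg int[U]} :=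
  \sum_(s <- msupp a) \sum_(t <- msupp b) << a@_s * b@_t *g op s t >>.

Lemma convEw (d1 : {fset S}) (d2 : {fset T}) a b :
  (msupp a `<=` d1)%fset -> (msupp b `<=` d2)%fset ->
  conv a b = \sum_(s <- d1) \sum_(t <- d2) << a@_s * b@_t *g op s t >>.
Proof.
move=> le1 le2; rewrite /conv (big_fset_incl _ le1) /=.
  apply: eq_bigr => s _; apply: big_fset_incl => // t _ /mcoeff_outdom ->.
  by rewrite mulr0 monalgU0.
move=> s _ /mcoeff_outdom as0.
by rewrite big1 // => t _; rewrite as0 mul0r monalgU0.
Qed.

Lemma convDl b : {morph conv^~ b : a a' / a + a'}.
Proof.
move=> a a'.
rewrite [in RHS](convEw (fsubsetUl (msupp a) (msupp a')) (fsubset_refl (msupp b))).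
rewrite (convEw (fsubsetUr (msupp a) (msupp a')) (fsubset_refl (msupp b))).
rewrite (convEw (msuppD_le a a') (fsubset_refl (msupp b))).
rewrite -big_split; apply: eq_bigr => s _; rewrite -big_split.
by apply: eq_bigr => t _; rewrite mcoeffD mulrDl monalgUD.
Qed.

Lemma convDr a : {morph conv a : b b' / b + b'}.
Proof.
move=> b b'.
rewrite (convEw (fsubset_refl (msupp a)) (fsubsetUl (msupp b) (msupp b'))).
rewrite (convEw (fsubset_refl (msupp a)) (fsubsetUr (msupp b) (msupp b'))).
rewrite (convEw (fsubset_refl (msupp a)) (msuppD_le b b')).
rewrite -big_split; apply: eq_bigr => s _; rewrite -big_split.
by apply: eq_bigr => t _; rewrite mcoeffD mulrDr monalgUD.
Qed.

Lemma conv0l b : conv 0 b = 0.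
Proof. by rewrite /conv msupp0 big_seq_fset0. Qed.

Lemma conv0r a : conv a 0 = 0.
Proof. by rewrite /conv big1 // => s _; rewrite msupp0 big_seq_fset0. Qed.

Lemma convUU (m n : int) s t :
  conv << m *g s >> << n *g t >> = << m * n *g op s t >>.
Proof.
by rewrite (convEw msuppU_le msuppU_le) !big_seq_fset1 !mcoeffUU.
Qed.

End Conv.

Lemma malg_indD (S : choiceType) (P : {malg int[S]} -> Prop) :
    P 0 -> (forall a b, P a -> P b -> P (a + b)) ->
    (forall (m : int) s, P << m *g s >>) ->
  forall a, P a.
Proof. by move=> P0 PD PU a; rewrite [a]monalgE; apply: big_ind. Qed.

Lemma convA (S1 S2 S12 T T2 U : choiceType) (f : S1 -> S2 -> S12)
    (g : S12 -> T -> U) (h : S2 -> T -> T2) (k : S1 -> T2 -> U) :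
    (forall x y z, k x (h y z) = g (f x y) z) ->
  forall a b c, conv k a (conv h b c) = conv g (conv f a b) c.
Proof.
move=> fE a b c; elim/malg_indD: a => [|a a' IH IH'|m x].
- by rewrite !conv0l.
- by rewrite !convDl IH IH'.
elim/malg_indD: b => [|b b' IH IH'|n y].
- by rewrite !(conv0l, conv0r).
- by rewrite !(convDl, convDr) IH IH'.
elim/malg_indD: c => [|c c' IH IH'|p z].
- by rewrite !conv0r.
- by rewrite !convDr IH IH'.
by rewrite !convUU fE mulrA.
Qed.

Lemma conv1l (S T : choiceType) (op : S -> T -> T) (s1 : S) :
  (forall t, op s1 t = t) -> forall a, conv op << s1 >> a = a.
Proof.
move=> op1; elim/malg_indD => [|a a' IH IH'|m x]; first by rewrite conv0r.
  by rewrite convDr IH IH'.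
by rewrite convUU op1 mul1r.
Qed.

Lemma conv1r (S T : choiceType) (op : S -> T -> S) (t1 : T) :
  (forall s, op s t1 = s) -> forall a, conv op a << t1 >> = a.
Proof.
move=> op1; elim/malg_indD => [|a a' IH IH'|m x]; first by rewrite conv0l.
  by rewrite convDl IH IH'.
by rewrite convUU op1 mulr1.
Qed.

(* The integral group ring. A fresh name is needed because the library's
   convolution ring on [{malg int[_]}] is restricted to monoids without
   nontrivial units. *)
Definition grpring (gT : groupType) : Type := {malg int[gT]}.

Section GroupRing.
Variable gT : groupType.

HB.instance Definition _ := GRing.Zmodule.on (grpring gT).

Definition grpring_mul : grpring gT -> grpring gT -> grpring gT :=
  conv (fun x y : gT => (x * y)%g).

Definition gelt (g : gT) : grpring gT := << g >>.

Fact grpring_mulA : associative grpring_mul.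
Proof. by apply: convA => x y z; rewrite mulgA. Qed.
Fact grpring_mul1l : left_id (gelt 1%g) grpring_mul.
Proof. by apply: conv1l => x; rewrite mul1g. Qed.
Fact grpring_mul1r : right_id (gelt 1%g) grpring_mul.
Proof. by apply: conv1r => x; rewrite mulg1. Qed.
Fact grpring_mulDl : left_distributive grpring_mul +%R.
Proof. by move=> a b c; apply: convDl. Qed.
Fact grpring_mulDr : right_distributive grpring_mul +%R.
Proof. by move=> a b c; apply: convDr. Qed.
Fact grpring_1neq0 : gelt 1%g != 0.
Proof. by rewrite [_ == _]monalgU_eq0 oner_eq0. Qed.

HB.instance Definition _ := GRing.Zmodule_isNzRing.Build (grpring gT)
  grpring_mulA grpring_mul1l grpring_mul1r grpring_mulDl grpring_mulDr
  grpring_1neq0.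

End GroupRing.

(* The cone of elements with nonnegative coefficients, used for both the
   group ring and the permutation modules. *)
Definition nonneg_coef (S : choiceType) (a : {malg int[S]}) : Prop :=
  forall s, 0 <= a@_s.

(* Left cosets [x D] and the permutation module on them. *)
Section PermModule.
Variables (gT : groupType) (D : groupClosed gT).

Definition coset_rel : rel gT := fun x y => (x^-1 * y)%g \in D.

Fact coset_rel_refl : reflexive coset_rel.
Proof. by move=> x; rewrite /coset_rel mulVg gpred1. Qed.
Fact coset_rel_sym : symmetric coset_rel.
Proof.
by move=> x y; rewrite /coset_rel -[in RHS]gpredV invgM invgK.
Qed.
Fact coset_rel_trans : transitive coset_rel.
Proof.
move=> y x z; rewrite /coset_rel => xy yz.
by have := gpredM _ _ xy yz; rewrite -mulgA mulVKg.
Qed.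

Canonical coset_equiv :=
  EquivRel coset_rel coset_rel_refl coset_rel_sym coset_rel_trans.

Definition cosets : choiceType := {eq_quot coset_equiv}%qT.

Definition coset_of_elt (x : gT) : cosets := (\pi_{eq_quot coset_equiv} x)%qT.

Definition coset_act (g : gT) (C : cosets) : cosets :=
  coset_of_elt (g * repr C)%g.

Fact coset_act_elt g x : coset_act g (coset_of_elt x) = coset_of_elt (g * x)%g.
Proof.
rewrite /coset_act /coset_of_elt; apply/eqmodP => /=.
case: piP => y /eqmodP /=; rewrite coset_rel_sym /coset_rel => xy.
by rewrite invgM -mulgA mulKg.
Qed.

Fact coset_eltP (C : cosets) : exists x, C = coset_of_elt x.
Proof. by exists (repr C); rewrite /coset_of_elt reprK. Qed.

Fact coset_act1 C : coset_act 1%g C = C.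
Proof. by have [x ->] := coset_eltP C; rewrite coset_act_elt mul1g. Qed.

Fact coset_actM g h C : coset_act g (coset_act h C) = coset_act (g * h)%g C.
Proof. by have [x ->] := coset_eltP C; rewrite !coset_act_elt mulgA. Qed.

Definition permmod : Type := {malg int[cosets]}.

HB.instance Definition _ := GRing.Zmodule.on permmod.

Definition permmod_scale : grpring gT -> permmod -> permmod := conv coset_act.

Fact permmod_scaleA a b v :
  permmod_scale a (permmod_scale b v) = permmod_scale (a * b) v.
Proof. exact: (convA coset_actM). Qed.
Fact permmod_scale1 : left_id (1 : grpring gT) permmod_scale.
Proof. exact: (conv1l coset_act1). Qed.
Fact permmod_scaleDr : right_distributive permmod_scale +%R.
Proof. by move=> a u v; apply: convDr. Qed.
Fact permmod_scaleDl v : {morph permmod_scale^~ v : a b / a + b}.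
Proof. exact: convDl. Qed.

HB.instance Definition _ := GRing.Zmodule_isLmodule.Build (grpring gT) permmod
  permmod_scaleA permmod_scale1 permmod_scaleDr permmod_scaleDl.

(* The left module map sending 1 to the coset of the identity. *)
Definition coset_proj (a : grpring gT) : permmod :=
  a *: (<< coset_of_elt 1%g >> : permmod).

Fact coset_proj_elt g : coset_proj (gelt g) = << coset_of_elt g >>.
Proof. by rewrite [LHS]convUU mulr1 coset_act_elt mulg1. Qed.

End PermModule.

(* The order is the library's boolean one, which is classically no
   restriction. *)
HB.mixin Record Lmodule_isOrderedGrpMod (gT : groupType) G
    of GRing.Lmodule (grpring gT) G & Num.POrderedZmodule G := {
  og_leD : forall h x y : G, x <= y -> x + h <= y + h;
  og_leZ : forall (g : gT) (x y : G), x <= y -> gelt g *: x <= gelt g *: y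
}.

#[short(type="ogrpType")]
HB.structure Definition OrderedGrpMod (gT : groupType) :=
  {G of Lmodule_isOrderedGrpMod gT G & GRing.Lmodule (grpring gT) G
      & Num.POrderedZmodule G}.

Section OrderedGroups.
Variable gT : groupType.
Implicit Types (G : ogrpType gT) (D : groupClosed gT).

Definition directed G : Prop :=
  forall x y : G, exists z : G, x <= z /\ y <= z.

Definition stab G : set gT :=
  [set g | forall x : G, gelt g *: x = x].

Definition order_unit G (u : G) : Prop :=
  0 <= u /\
  forall x : G, exists a : grpring gT,
    [/\ a != 0, nonneg_coef a & x <= a *: u].

Definition generating_interval G (I : set G) : Prop :=
  [/\ I 0,
      (forall x, I x -> 0 <= x),
      (forall x y, I x -> I y -> exists z, [/\ I z, x <= z & y <= z]),
      (forall x y z, I x -> I y -> x <= z -> z <= y -> I z) &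
      (forall x, 0 <= x -> exists (k : nat) (a : 'I_k -> grpring gT)
           (d : 'I_k -> G),
         [/\ forall i, nonneg_coef (a i), forall i, I (d i) &
             x = \sum_(i < k) a i *: d i])].

Definition order_interval G (u : G) : set G := [set x | 0 <= x <= u].

(* The family [x] enumerates a finite set: the last clause forces it to be
   injective. *)
Definition simplicial_basis D (G : lmodType (grpring gT)) (n : nat)
    (x : 'I_n -> G) : Prop :=
  (forall i g, gelt g *: x i = x i <-> g \in D) /\
  (forall a b : 'I_n -> grpring gT,
    (forall i, nonneg_coef (coset_proj D (a i))) ->
    (forall i, nonneg_coef (coset_proj D (b i))) ->
    (\sum_(i < n) a i *: x i = \sum_(i < n) b i *: x i <->
     forall i, coset_proj D (a i - b i) = 0)).

Definition simplicial_cone D (G : lmodType (grpring gT)) (n : nat)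
    (x : 'I_n -> G) : set G :=
  [set z | exists a : 'I_n -> grpring gT,
     (forall i, nonneg_coef (coset_proj D (a i))) /\
     z = \sum_(i < n) a i *: x i].

(* The zero group has the empty basis, which counts as stabilized by any [D]. *)
Definition simplicial D G : Prop :=
  (exists (n : nat) (x : 'I_n -> G),
     [/\ simplicial_basis D x,
         (forall y z : G, y <= z <-> simplicial_cone D x (z - y)) &
         directed G])
  \/ (forall x : G, x = 0).

Record unitalGroup := UnitalGroup {
  ug_group :> ogrpType gT;
  ug_unit : ug_group;
  ug_unitP : order_unit ug_unit }.

Record intervalGroup := IntervalGroup {
  ig_group :> ogrpType gT;
  ig_interval : set ig_group;
  ig_intervalP : generating_interval ig_interval }.

Definition unital_hom (A B : unitalGroup) (f : {linear A -> B}) : Prop :=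
  {homo f : x y / x <= y} /\ f (ug_unit A) = ug_unit B.

Definition interval_hom (A B : intervalGroup) (f : {linear A -> B}) : Prop :=
  {homo f : x y / x <= y} /\
  forall x, ig_interval x -> ig_interval (f x).

End OrderedGroups.

(* [L] is a direct limit (sequential colimit) of the objects [X n] in the
   category with objects [Obj] and with morphisms the linear maps between the
   underlying modules that satisfy [hom]. *)
Section DirectLimit.
Variables (R : nzRingType) (Obj : Type) (mod_of : Obj -> lmodType R).
Variable hom : forall A B : Obj, {linear mod_of A -> mod_of B} -> Prop.

Definition cocone (X : nat -> Obj)
    (f : forall n, {linear mod_of (X n) -> mod_of (X n.+1)}) (L : Obj)
    (phi : forall n, {linear mod_of (X n) -> mod_of L}) : Prop :=
  (forall n, hom (phi n)) /\ (forall n, phi n.+1 \o f n =1 phi n).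

Definition direct_limit (X : nat -> Obj) (L : Obj) : Prop :=
  exists (f : forall n, {linear mod_of (X n) -> mod_of (X n.+1)})
         (phi : forall n, {linear mod_of (X n) -> mod_of L}),
    [/\ forall n, hom (f n),
        cocone f phi &
        forall (M : Obj) (psi : forall n, {linear mod_of (X n) -> mod_of M}),
          cocone f psi ->
          exists h : {linear mod_of L -> mod_of M},
            [/\ hom h, forall n, h \o phi n =1 psi n &
                forall h' : {linear mod_of L -> mod_of M},
                  hom h' -> (forall n, h' \o phi n =1 psi n) -> h' =1 h]].

End DirectLimit.

Section Classes.
Variable gT : groupType.
Implicit Types (G : ogrpType gT) (D : groupClosed gT).

Definition ultrasimplicial_unit G : Prop :=
  exists (u : G) (uP : order_unit u) (D : groupClosed gT)
         (X : nat -> unitalGroup gT),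
    (forall n, simplicial D (X n)) /\
    direct_limit (mod_of := fun A : unitalGroup gT => A) (@unital_hom gT)
      X (UnitalGroup uP).

Definition ultrasimplicial_interval G : Prop :=
  exists (I : set G) (IP : generating_interval I) (D : groupClosed gT)
         (X : nat -> intervalGroup gT),
    [/\ forall n, simplicial D (X n),
        forall n, exists u : X n,
          order_unit u /\ ig_interval (i := X n) = order_interval u &
        direct_limit (mod_of := fun A : intervalGroup gT => A)
          (@interval_hom gT) X (IntervalGroup IP)].

Definition ultrasimplicial G : Prop :=
  directed G /\ (ultrasimplicial_unit G \/ ultrasimplicial_interval G).

Definition SDP D G : Prop :=
  forall (n : nat) (a : 'I_n -> grpring gT) (x : 'I_n -> G),
    (forall i, 0 <= x i) -> \sum_(i < n) a i *: x i = 0 ->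
    exists (m : nat) (b : 'I_n -> 'I_m -> grpring gT) (y : 'I_m -> G),
      [/\ (0 < m)%N,
          forall i j, nonneg_coef (b i j),
          forall j, 0 <= y j,
          forall i, x i = \sum_(j < m) b i j *: y j &
          forall j, \sum_(i < n) coset_proj D (a i * b i j) = 0].

Definition dimension_group G : Prop :=
  directed G /\
  exists D : groupClosed gT, (forall g, g \in D -> stab G g) /\ SDP D G.

End Classes.

Definition finitely_generated (gT : groupType) : Prop :=
  exists S : seq gT, forall H : groupClosed gT,
    {subset S <= H} -> forall g : gT, g \in H.

(* Main.v *)
Require Import Defs.
From HB Require Import structures.
From mathcomp Require Import all_boot all_order all_algebra.
From mathcomp Require Import classical_sets cardinality.
From mathcomp Require Import boolp finmap monalg.

(** Write [D] for the subgroup by which the simplicial bases are stabilized,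
    and [SDP] for the decomposition property relative to [D].

    Both directions rest on one description of direct limits ([seq_limit]): a
    cocone [phi n : X n -> L] is a limit when every element of [L], and every
    positive element as a positive one, comes from some [X n], and when
    whatever [phi n] kills already dies at some later stage.

    From ultrasimplicial to dimension group.  The definition only provides a
    universal property, so the sequence is first given a concrete limit
    [colim], the group of germs at infinity, ordered by the images of the
    positive elements; it carries an order-unit or a generating interval
    according to the category ([colim_order_unit],
    [colim_generating_interval]).  Testing the universal property against it
    makes [G] a retract of [colim], compatibly with the maps from the
    sequence, so that [G] has the three properties above
    ([universal_seq_limit]).  In a simplicial group, writing elements in the
    basis gives [SDP] at once ([simplicial_SDP]), and [SDP] passes to the limit
    because a relation between positive elements of [G] lifts to a relation
    between positive elements of some [X n] ([seq_limit_SDP]).  Since the acting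
    group is abelian, [D] acts trivially on modules spanned by elements which
    it fixes ([simplicial_trivial]).  Since it is finitely generated, its group
    ring is countable, hence so is each simplicial group, hence so is [G]
    ([seq_limit_enumerated]).

    From dimension group to ultrasimplicial.  Take the whole positive cone of
    [G] as generating interval.  The simplicial groups are powers [permpow D k]
    of the permutation module on the cosets of [D]; as [D] acts trivially on
    [G], linear maps out of them are given by arbitrary images of the [k]
    generators ([permpow_ext]), and they are positive when these images are.
    Given a positive map [phi] from such a power to [G], an element [r] with
    [phi r = 0] and a positive [g] in [G], the equation [phi r = 0] is a
    relation between the images of the generators, to which [g] is added with
    coefficient 0.  [SDP] then expresses the images and [g] through positive
    elements [y j], with coefficients that make the relation vanish: [phi]
    factors through a new power, whose generators go to the [y j], in which
    [r] becomes zero and [g] is reached ([stage_extension]).  Everything in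
    sight being countable, an iteration of this step can be scheduled so that
    every element of every kernel is eventually killed and every positive
    element of [G] is eventually reached
    ([dimension_ultrasimplicial_interval]). *)

Set Implicit Arguments.
Unset Strict Implicit.
Unset Printing Implicit Defensive.

Import Order.TTheory GRing.Theory Num.Theory.
Local Open Scope ring_scope.

(** * Nonnegative coefficients and the permutation module *)

Section NonnegCoef.
Variable S : choiceType.

Lemma nonneg_coef0 : nonneg_coef (0 : {malg int[S]}).
Proof. by move=> s; rewrite mcoeff0. Qed.

Lemma nonneg_coefD (a b : {malg int[S]}) :
  nonneg_coef a -> nonneg_coef b -> nonneg_coef (a + b).
Proof. by move=> a0 b0 s; rewrite mcoeffD addr_ge0. Qed.

Lemma nonneg_coefU (m : int) (s : S) : 0 <= m -> nonneg_coef << m *g s >>.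
Proof. by move=> m0 t; rewrite mcoeffU mulrn_wge0. Qed.

Lemma nonneg_coef_anti (a : {malg int[S]}) :
  nonneg_coef a -> nonneg_coef (- a) -> a = 0.
Proof.
move=> a0 na0; apply/malgP => s; apply/eqP; rewrite mcoeff0 eq_le a0 andbT.
by rewrite -oppr_ge0 -mcoeffN na0.
Qed.

Lemma nonneg_coef_split (a : {malg int[S]}) : exists p q,
  [/\ nonneg_coef p, nonneg_coef q & a = p - q].
Proof.
elim/malg_indD: a => [|a b [p [q [p0 q0 ->]]] [p' [q' [p'0 q'0 ->]]]|m s].
- by exists 0, 0; split; rewrite ?subr0 //; exact: nonneg_coef0.
- exists (p + p'), (q + q'); split; [exact: nonneg_coefD..|].
  by rewrite opprD addrACA.
have [m0|/ltW m0] := leP 0 m.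
  exists << m *g s >>, 0; rewrite subr0.
  by split=> //; [exact: nonneg_coefU | exact: nonneg_coef0].
exists 0, << - m *g s >>; rewrite sub0r -monalgUN opprK.
by split=> //; [exact: nonneg_coef0 | apply: nonneg_coefU; rewrite oppr_ge0].
Qed.

End NonnegCoef.

Lemma nonneg_coef_conv (S T U : choiceType) (op : S -> T -> U) a b :
  nonneg_coef a -> nonneg_coef b -> nonneg_coef (conv op a b).
Proof.
move=> a0 b0; rewrite /conv.
apply: big_ind => [||s _]; [exact: nonneg_coef0 | exact: nonneg_coefD |].
apply: big_ind => [||t _]; [exact: nonneg_coef0 | exact: nonneg_coefD |].
by apply: nonneg_coefU; rewrite mulr_ge0.
Qed.

Section GroupRing.
Variable gT : groupType.
Implicit Types (a b : grpring gT) (g : gT).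

(** Induction on the free abelian group, with the operations read in the
    ring. *)
Lemma grpring_ind (P : grpring gT -> Prop) :
    P 0 -> (forall a b, P a -> P b -> P (a + b)) ->
    (forall (m : int) g, P << m *g g >>) ->
  forall a, P a.
Proof. exact: malg_indD. Qed.

(** Multiplying by a monomial of the group ring is acting by a group element
    and then taking an integer multiple, which is how positivity and triviality
    of the action extend from group elements to the whole ring. *)
Lemma gelt_malgUz (m : int) g : << m *g g >> = gelt g *~ m :> grpring gT.
Proof.
have natE n : << n%:Z *g g >> = gelt g *+ n :> grpring gT.
  by elim: n => [|n IH]; rewrite ?monalgU0 // mulrSr -IH -monalgUD -PoszD addn1.
case: m => n; first by rewrite natE.
by rewrite NegzE monalgUN natE mulrNz.
Qed.

Lemma grpring_mulC (abel : forall g h : gT, commute g h) a b :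
  a * b = b * a.
Proof.
elim/grpring_ind: a => [|a a' IH IH'|m x]; first by rewrite mul0r mulr0.
  by rewrite mulrDl mulrDr IH IH'.
elim/grpring_ind: b => [|b b' IH IH'|n y]; first by rewrite mul0r mulr0.
  by rewrite mulrDl mulrDr IH IH'.
rewrite [LHS]convUU [RHS]convUU mulrC.
by have -> : (x * y)%g = (y * x)%g by exact: abel.
Qed.

End GroupRing.

Section CosetLift.
Variables (gT : groupType) (D : groupClosed gT).
Implicit Types (a b : grpring gT) (v w : permmod D).

Lemma permmod_ind (P : permmod D -> Prop) :
    P 0 -> (forall v w, P v -> P w -> P (v + w)) ->
    (forall (m : int) C, P << m *g C >>) ->
  forall v, P v.
Proof. exact: malg_indD. Qed.

(** The additive section of [coset_proj] that represents each coset by its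
    chosen element. It preserves nonnegativity, so elements of the cone of the
    permutation module lift to the cone of the group ring. *)
Definition coset_lift v : grpring gT :=
  conv (fun (C : cosets D) (_ : unit) => repr C) v << tt >>.

Lemma coset_liftD v w : coset_lift (v + w) = coset_lift v + coset_lift w.
Proof. exact: convDl. Qed.

Lemma coset_liftU (m : int) (C : cosets D) :
  coset_lift (<< m *g C >> : permmod D) = << m *g repr C >>.
Proof. by rewrite [LHS]convUU mulr1. Qed.

Lemma coset_lift0 : coset_lift 0 = 0.
Proof. exact: conv0l. Qed.

Lemma nonneg_coset_lift v : nonneg_coef v -> nonneg_coef (coset_lift v).
Proof. by move=> v0; apply: nonneg_coef_conv => //; apply: nonneg_coefU. Qed.

Lemma coset_projU (m : int) g :
  coset_proj D (<< m *g g >> : grpring gT) = << m *g coset_of_elt D g >>.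
Proof. by rewrite [LHS]convUU mulr1 coset_act_elt mulg1. Qed.

Lemma coset_projD a b :
  coset_proj D (a + b) = coset_proj D a + coset_proj D b.
Proof. exact: scalerDl. Qed.

Lemma coset_projB a b :
  coset_proj D (a - b) = coset_proj D a - coset_proj D b.
Proof. exact: scalerBl. Qed.

Lemma coset_proj0 : coset_proj D 0 = 0.
Proof. exact: scale0r. Qed.

Lemma coset_projM a b : coset_proj D (a * b) = a *: coset_proj D b.
Proof. by rewrite /coset_proj scalerA. Qed.

Lemma coset_projZ1 a : a *: coset_proj D 1 = coset_proj D a.
Proof. by rewrite -coset_projM mulr1. Qed.

Lemma coset_proj_sum (I : Type) (r : seq I) (F : I -> grpring gT) :
  coset_proj D (\sum_(i <- r) F i) = \sum_(i <- r) coset_proj D (F i).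
Proof. exact: scaler_suml. Qed.

Lemma nonneg_coset_proj a : nonneg_coef a -> nonneg_coef (coset_proj D a).
Proof. by move=> a0; apply: nonneg_coef_conv => //; apply: nonneg_coefU. Qed.

Lemma coset_liftK v : coset_proj D (coset_lift v) = v.
Proof.
elim/permmod_ind: v => [|v w IHv IHw|m C].
- by rewrite coset_lift0 coset_proj0.
- by rewrite coset_liftD coset_projD IHv IHw.
by rewrite coset_liftU coset_projU /coset_of_elt reprK.
Qed.

Definition trivial_on (M : lmodType (grpring gT)) (x : M) : Prop :=
  forall g, g \in D -> gelt g *: x = x.

(** An element fixed by [D] only sees coefficients through their image in the
    permutation module, because the representative of a coset [g D] differs
    from [g] by a factor in [D]. *)
Lemma coset_proj_lift_act (M : lmodType (grpring gT)) (x : M) a :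
  trivial_on x -> coset_lift (coset_proj D a) *: x = a *: x.
Proof.
move=> Dx; elim/grpring_ind: a => [|a b IHa IHb|m g].
- by rewrite coset_proj0 coset_lift0 !scale0r.
- rewrite coset_projD coset_liftD [LHS]scalerDl [RHS]scalerDl.
  by congr (_ + _).
rewrite coset_projU coset_liftU !gelt_malgUz.
suff: gelt (repr (coset_of_elt D g)) *: x = gelt g *: x.
  by move=> E; rewrite -[LHS]scalerMzl -[RHS]scalerMzl; congr (_ *~ _).
have [d dD ->] : exists2 d, d \in D & repr (coset_of_elt D g) = (g * d)%g.
  exists (g^-1 * repr (coset_of_elt D g))%g; last by rewrite mulVKg.
  rewrite /coset_of_elt; case: piP => y /eqmodP /=.
  by rewrite /coset_rel.
have -> : gelt (g * d)%g = gelt g * gelt d :> grpring gT.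
  by rewrite [RHS]convUU mulr1.
by rewrite -scalerA Dx.
Qed.

Lemma coset_proj_eq1 g : coset_proj D (gelt g) = coset_proj D 1 <-> g \in D.
Proof.
have -> : (1 : grpring gT) = gelt 1%g by [].
rewrite !coset_proj_elt; split=> [/malgP/(_ (coset_of_elt D g)) | gD].
  rewrite !mcoeffU eqxx; case: eqP => // /eqmodP /=.
  by rewrite /coset_rel invg1 mul1g.
by congr << _ >>; apply/eqmodP; rewrite /= /coset_rel mulg1 gpredV.
Qed.

End CosetLift.

(** * Ordered groups and powers of the permutation module *)

Section OrderedGroupTheory.
Variables (gT : groupType) (G : ogrpType gT).
Implicit Types (x y z : G) (a : grpring gT).

Lemma og_subr_ge0 x y : (0 <= y - x) = (x <= y).
Proof.
apply/idP/idP => [/(og_leD x)|/(og_leD (- x))]; last by rewrite subrr.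
by rewrite add0r subrK.
Qed.

Lemma og_addr_ge0 x y : 0 <= x -> 0 <= y -> 0 <= x + y.
Proof.
by move=> x0 y0; apply: le_trans y0 _; rewrite -og_subr_ge0 addrK.
Qed.

Lemma og_lerD x y x' y' : x <= y -> x' <= y' -> x + x' <= y + y'.
Proof.
move=> xy x'y'; rewrite -og_subr_ge0 opprD addrACA.
by apply: og_addr_ge0; rewrite og_subr_ge0.
Qed.

Lemma og_sum_ge0 (I : Type) (r : seq I) (F : I -> G) :
  (forall i, 0 <= F i) -> 0 <= \sum_(i <- r) F i.
Proof. by move=> F0; elim/big_rec: _ => // i x _; apply: og_addr_ge0. Qed.

(** The axioms only speak of group elements; a nonnegative combination of them
    acts positively because sums of positive elements are positive. *)
Lemma og_scale_ge0 a x : nonneg_coef a -> 0 <= x -> 0 <= a *: x.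
Proof.
move=> a0 x0; rewrite [a]monalgE scaler_suml; apply: og_sum_ge0 => g.
move: (a0 g); case: (a@_g) => // n _.
rewrite gelt_malgUz -pmulrn -scalerMnl.
elim: n => [|n IH]; first by rewrite mulr0n.
rewrite mulrSr; apply: og_addr_ge0 => //.
by rewrite -[0](scaler0 _ (gelt g)); apply: og_leZ.
Qed.

Lemma og_directed_split : directed G ->
  forall x, exists p q, [/\ 0 <= p, 0 <= q & x = p - q].
Proof.
move=> dirG x; have [z [xz z0]] := dirG x 0.
exists z, (z - x); rewrite og_subr_ge0; split=> //.
by rewrite opprB addrC subrK.
Qed.

End OrderedGroupTheory.

Lemma linear_homo (gT : groupType) (A B : ogrpType gT) (f : {linear A -> B}) :
  (forall x, 0 <= x -> 0 <= f x) -> {homo f : x y / x <= y}.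
Proof.
by move=> f0 x y; rewrite -!(og_subr_ge0 x, og_subr_ge0 (f x)) -raddfB => /f0.
Qed.

Lemma linear_homo_ge0 (gT : groupType) (A B : ogrpType gT)
    (f : {linear A -> B}) :
  {homo f : x y / x <= y} -> forall x, 0 <= x -> 0 <= f x.
Proof. by move=> fm x x0; rewrite -(raddf0 f); apply: fm. Qed.

(** The simplicial group on [k] generators stabilized by [D], ordered
    coordinatewise. For a given [D] it depends on [k] alone, which makes
    sequences of such groups and of maps between them easy to form. *)
Definition permpow (gT : groupType) (D : groupClosed gT) (k : nat) : Type :=
  {ffun 'I_k -> permmod D}.

Section Simp.
Variables (gT : groupType) (D : groupClosed gT) (k : nat).
Local Notation X := (permpow D k).

HB.instance Definition _ := GRing.Lmodule.on X.

Definition permpow_le (v w : X) : bool :=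
  `[< forall i, nonneg_coef (w i - v i) >].

Fact permpow_le_refl : reflexive permpow_le.
Proof.
by move=> v; apply/asboolP => i; rewrite subrr; apply: nonneg_coef0.
Qed.
Fact permpow_le_anti : antisymmetric permpow_le.
Proof.
move=> v w /andP[/asboolP vw /asboolP wv]; apply/ffunP => i; apply/eqP.
rewrite eq_sym -subr_eq0; apply/eqP/nonneg_coef_anti; first exact: vw.
by have := wv i; rewrite -(opprB (w i)); apply.
Qed.
Fact permpow_le_trans : transitive permpow_le.
Proof.
move=> v u w /asboolP uv /asboolP vw; apply/asboolP => i.
by rewrite -[w i](subrK (v i)) -addrA; apply: nonneg_coefD.
Qed.

HB.instance Definition _ := Order.Le_isPOrder.Build ring_display X
  permpow_le_refl permpow_le_anti permpow_le_trans.

Lemma permpow_leE (v w : X) : v <= w <-> forall i, nonneg_coef (w i - v i).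
Proof. by split=> [/asboolP|H]; last exact/asboolP. Qed.

Fact permpow_leD (u v w : X) : v <= w -> v + u <= w + u.
Proof.
move=> /permpow_leE vw; apply/permpow_leE => i.
by rewrite !ffunE opprD addrACA subrr addr0.
Qed.
Fact permpow_leZ (g : gT) (v w : X) : v <= w -> gelt g *: v <= gelt g *: w.
Proof.
move=> /permpow_leE vw; apply/permpow_leE => i.
rewrite !ffunE -scalerBr; apply: nonneg_coef_conv => //.
by apply: nonneg_coefU.
Qed.

HB.instance Definition _ := Lmodule_isOrderedGrpMod.Build gT X
  permpow_leD permpow_leZ.

Lemma permpow_ge0 (v : X) : 0 <= v <-> forall i, nonneg_coef (v i).
Proof.
split=> [/permpow_leE v0 i|v0]; first by have := v0 i; rewrite ffunE subr0.
by apply/permpow_leE => i; rewrite ffunE subr0.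
Qed.

Definition permpow_gen (i : 'I_k) : X :=
  [ffun j => if j == i then coset_proj D 1 else 0].

Lemma permpow_combE (a : 'I_k -> grpring gT) i :
  (\sum_j a j *: permpow_gen j) i = coset_proj D (a i).
Proof.
have aE j : (a j *: permpow_gen j) i = if j == i then coset_proj D (a j) else 0.
  rewrite [LHS]ffunE [permpow_gen _ _]ffunE eq_sym.
  by case: eqP => _; [exact: coset_projZ1 | exact: scaler0].
by rewrite sum_ffunE (eq_bigr _ (fun j _ => aE j)) -big_mkcond big_pred1_eq.
Qed.

Lemma permpow_gen_span (v : X) : v = \sum_i coset_lift (v i) *: permpow_gen i.
Proof. by apply/ffunP => i; rewrite permpow_combE coset_liftK. Qed.

Lemma permpow_gen_ge0 i : 0 <= permpow_gen i.
Proof.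
apply/permpow_ge0 => j; rewrite ffunE; case: ifP => _; last exact: nonneg_coef0.
by apply/nonneg_coset_proj/nonneg_coefU.
Qed.

Lemma permpow_basis : simplicial_basis D permpow_gen.
Proof.
split=> [i g|a b _ _].
  rewrite -(coset_proj_eq1 D g); split=> [/ffunP/(_ i)|].
    by rewrite [LHS]ffunE [permpow_gen _ _]ffunE eqxx coset_projZ1.
  move=> Dg; apply/ffunP => j; rewrite [LHS]ffunE [permpow_gen _ _]ffunE.
  by case: eqP => _; [rewrite coset_projZ1 | exact: scaler0].
split=> [/ffunP ab i|ab].
  apply/eqP; rewrite coset_projB subr_eq0; apply/eqP.
  by have := ab i; rewrite [LHS]permpow_combE [RHS]permpow_combE.
apply/ffunP => i; rewrite [LHS]permpow_combE [RHS]permpow_combE; apply/eqP.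
by rewrite -subr_eq0 -coset_projB ab.
Qed.

Lemma permpow_directed : directed (permpow D k : ogrpType gT).
Proof.
have split1 (v : X) : exists2 p : X, 0 <= p & v <= p.
  have /choice[p pP] : forall i, exists p : permmod D,
      nonneg_coef p /\ nonneg_coef (p - v i).
    move=> i; have [p [q [p0 q0 ->]]] := nonneg_coef_split (v i).
    by exists p; split=> //; rewrite opprB addrC subrK.
  exists [ffun i => p i].
    by apply/permpow_ge0 => i; rewrite ffunE; apply: (pP i).1.
  by apply/permpow_leE => i; rewrite ffunE; apply: (pP i).2.
move=> v w; have [p p0 vp] := split1 v; have [q q0 wq] := split1 w.
exists (p + q); split; rewrite -og_subr_ge0.
  by rewrite addrAC; apply: og_addr_ge0 => //; rewrite og_subr_ge0.
by rewrite -addrA; apply: og_addr_ge0 => //; rewrite og_subr_ge0.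
Qed.

Lemma permpow_simplicial : simplicial D (permpow D k : ogrpType gT).
Proof.
left; exists k, permpow_gen.
split; [exact: permpow_basis | | exact: permpow_directed].
move=> v w; rewrite -og_subr_ge0; split=> [/permpow_ge0 vw|[a [a0 vwE]]].
  exists (fun i => coset_lift ((w - v) i)).
  by split=> [i|]; rewrite ?coset_liftK -?permpow_gen_span.
by apply/permpow_ge0 => i; rewrite vwE permpow_combE.
Qed.

(** The generators are fixed by [D], and commutativity moves an element of [D]
    past the coefficients. *)
Lemma permpow_trivial (abel : forall g h : gT, commute g h) (v : X) :
  trivial_on D v.
Proof.
move=> g gD; rewrite [v]permpow_gen_span scaler_sumr; apply: eq_bigr => i _.
rewrite scalerA (grpring_mulC abel) -scalerA; congr (_ *: _).
by apply/(permpow_basis.1 i g).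
Qed.

(** This is the universal property of the permutation module: each generator
    can be sent to any element fixed by [D]. Lifting coefficients to the group
    ring gives the map; it is linear because the choice of lift does not matter
    on such elements. *)
Lemma permpow_ext (M : lmodType (grpring gT)) (y : 'I_k -> M) :
    (forall i, trivial_on D (y i)) ->
  exists f : {linear X -> M}, forall i, f (permpow_gen i) = y i.
Proof.
move=> Dy; pose f (v : X) : M := \sum_i coset_lift (v i) *: y i.
have fl : linear f.
  move=> a v w; rewrite /f scaler_sumr -big_split; apply: eq_bigr => i _ /=.
  rewrite !ffunE coset_liftD scalerDl; congr (_ + _).
  rewrite -{1}[v i]coset_liftK -coset_projM.
  by rewrite coset_proj_lift_act // scalerA.
pose L := GRing.isLinear.Build _ _ _ _ f fl.
pose fL : {linear X -> M} := HB.pack f L.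
exists fL => i; rewrite /= /f (bigD1 i) //= ffunE eqxx big1 ?addr0.
  by rewrite coset_proj_lift_act // scale1r.
by move=> j /negPf ij; rewrite ffunE ij coset_lift0 scale0r.
Qed.

Lemma permpow_linE (M : lmodType (grpring gT)) (f : {linear X -> M}) (v : X) :
  f v = \sum_i coset_lift (v i) *: f (permpow_gen i).
Proof.
rewrite {1}[v]permpow_gen_span linear_sum; apply: eq_bigr => i _.
by rewrite linearZ.
Qed.

Lemma permpow_lin_ge0 (A : ogrpType gT) (f : {linear X -> A}) :
  (forall i, 0 <= f (permpow_gen i)) -> forall v, 0 <= v -> 0 <= f v.
Proof.
move=> f0 v /permpow_ge0 v0; rewrite permpow_linE; apply: og_sum_ge0 => i.
exact/og_scale_ge0/f0/nonneg_coset_lift.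
Qed.

Lemma permpow_lin_eq (M : lmodType (grpring gT)) (f g : {linear X -> M}) :
  (forall i, f (permpow_gen i) = g (permpow_gen i)) -> f =1 g.
Proof.
by move=> fg v; rewrite !permpow_linE; apply: eq_bigr => i _; rewrite fg.
Qed.

End Simp.

(** * Sequential colimits of ordered groups *)

Section Transition.
Variables (R : nzRingType) (X : nat -> lmodType R).
Variable f : forall n, {linear X n -> X n.+1}.

(** The composite of the maps from stage [n] to stage [m]. It is total in [n]
    and [m], with value 0 when [m < n], so that no transport along equations
    between indices appears in the statements. *)
Fixpoint transition n m : X n -> X m :=
  match m return X n -> X m with
  | 0 => fun x => if n =P 0%N is ReflectT e then ecast i (X i) e x else 0
  | m'.+1 => fun x => if n =P m'.+1 is ReflectT e then ecast i (X i) e x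
                      else f m' (@transition n m' x)
  end.
Arguments transition n m x : clear implicits.

Lemma transition_id n x : transition n n x = x.
Proof.
by case: n x => [|n] x /=; case: eqP => // e; rewrite eq_axiomK.
Qed.

Lemma transitionS n m x :
  (n <= m)%N -> transition n m.+1 x = f m (transition n m x).
Proof. by move=> nm /=; case: eqP => // e; rewrite e ltnn in nm. Qed.

Lemma transition_ind n x (P : forall m, X m -> Prop) :
    P n x -> (forall m y, P m y -> P m.+1 (f m y)) ->
  forall m, (n <= m)%N -> P m (transition n m x).
Proof.
move=> Pn Pf; elim=> [|m IH] nm.
  have n0 : n = 0%N by apply/eqP; rewrite -leqn0.
  by subst n; rewrite transition_id.
move: nm; rewrite leq_eqVlt => /orP[/eqP nm|]; last rewrite ltnS => nm.
  by subst n; rewrite transition_id.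
by rewrite transitionS //; apply/Pf/IH.
Qed.

Lemma transition_linear n m : linear (@transition n m).
Proof.
move=> a x y; elim: m => [|m IH] /=; case: eqP => [e|_].
- by case: _ / e.
- by rewrite scaler0 addr0.
- by case: _ / e.
by rewrite IH linearP.
Qed.
HB.instance Definition _ n m :=
  GRing.isLinear.Build R (X n) (X m) _ (@transition n m)
    (@transition_linear n m).

Lemma transition_trans n m p x : (n <= m <= p)%N ->
  transition m p (transition n m x) = transition n p x.
Proof.
elim: p => [|p IH] /andP[nm mp].
  have m0 : m = 0%N by apply/eqP; rewrite -leqn0.
  by subst m; rewrite transition_id.
move: mp; rewrite leq_eqVlt => /orP[/eqP mp|]; last rewrite ltnS => mp.
  by subst m; rewrite transition_id.
by rewrite !transitionS ?(leq_trans nm) // IH ?nm.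
Qed.

Lemma transition_cocone (L : lmodType R) (phi : forall n, {linear X n -> L}) :
    (forall n, phi n.+1 \o f n =1 phi n) ->
  forall n m x, (n <= m)%N -> phi m (transition n m x) = phi n x.
Proof.
move=> phif n m x.
apply: (@transition_ind n x (fun k y => phi k y = phi n x)) => // k y <-.
exact: phif.
Qed.

(** Algebraic half of the universal property: [h] is computed on any lift. *)
Lemma colimit_factor (L M : lmodType R) (phi : forall n, {linear X n -> L})
    (psi : forall n, {linear X n -> M}) :
    (forall n, phi n.+1 \o f n =1 phi n) ->
    (forall n, psi n.+1 \o f n =1 psi n) ->
    (forall l, exists n x, phi n x = l) ->
    (forall n x, phi n x = 0 ->
       exists2 m, (n <= m)%N & transition n m x = 0) ->
  exists h : {linear L -> M}, forall n, h \o phi n =1 psi n.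
Proof.
move=> phif psif surj ker.
(* Two lifts of the same element agree from some stage on, so [psi] takes
   the same value on them. *)
have wd n m x y : phi n x = phi m y -> psi n x = psi m y.
  set k := maxn n m; move=> xy.
  have nk : (n <= k)%N by rewrite leq_maxl.
  have mk : (m <= k)%N by rewrite leq_maxr.
  have /ker[p kp] : phi k (transition n k x - transition m k y) = 0.
    by rewrite raddfB /= !(transition_cocone phif) // xy subrr.
  rewrite raddfB /= => /(congr1 (psi p)).
  rewrite raddf0 raddfB /= !(transition_cocone psif) //.
  by move=> /eqP; rewrite subr_eq0 => /eqP.
have /choice[c cP] : forall l, exists c : {n & X n},
    phi (tag c) (tagged c) = l.
  by move=> l; have [n [x <-]] := surj l; exists (Tagged (fun n => X n) x).
pose h l := psi (tag (c l)) (tagged (c l)).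
have hphi n x : h (phi n x) = psi n x by apply: wd; rewrite cP.
have hl : linear h.
  move=> a u v; have [n [x <-]] := surj u; have [m [y <-]] := surj v.
  have nk : (n <= maxn n m)%N by rewrite leq_maxl.
  have mk : (m <= maxn n m)%N by rewrite leq_maxr.
  rewrite -(transition_cocone phif x nk) -(transition_cocone phif y mk).
  by rewrite -linearP !hphi linearP.
pose hL : {linear L -> M} := HB.pack h (GRing.isLinear.Build _ _ _ _ h hl).
by exists hL => n x; exact: hphi.
Qed.

End Transition.
Arguments transition {R X} f n m x.

Record osys (gT : groupType) := OSys {
  os_mod :> nat -> ogrpType gT;
  os_map : forall n, {linear os_mod n -> os_mod n.+1};
  os_homo : forall n, {homo os_map n : x y / x <= y} }.

Section Colimit.
Variables (gT : groupType) (X : osys gT).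
Local Notation R := (grpring gT).
Let Xm : nat -> lmodType R := fun n => X n.
Local Notation tr := (transition (X := Xm) (@os_map gT X)).

(** Two elements are identified when their images agree at all sufficiently
    large stages. Since [transition] is total, this is literally equality of
    germs at infinity, and transitivity needs no bookkeeping of stages. *)
Definition germ_rel : rel {n & X n} := fun c d =>
  `[< exists K0, forall K, (K0 <= K)%N ->
        tr _ K (tagged c) = tr _ K (tagged d) >].

Fact germ_rel_refl : reflexive germ_rel.
Proof. by move=> c; apply/asboolP; exists 0%N. Qed.
Fact germ_rel_sym : symmetric germ_rel.
Proof.
by move=> c d; apply/asboolP/asboolP => -[K KP]; exists K => k /KP ->.
Qed.
Fact germ_rel_trans : transitive germ_rel.
Proof.
move=> d c e /asboolP[K KP] /asboolP[L LP]; apply/asboolP.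
by exists (maxn K L) => k; rewrite geq_max => /andP[/KP -> /LP ->].
Qed.
Canonical germ_equiv :=
  EquivRel germ_rel germ_rel_refl germ_rel_sym germ_rel_trans.

Definition colim : Type := {eq_quot germ_equiv}%qT.
HB.instance Definition _ := Choice.on colim.

Definition colim_in n (x : X n) : colim :=
  (\pi_{eq_quot germ_equiv} (Tagged (fun n => X n) x))%qT.

Lemma colim_in_eq n m (x : X n) (y : X m) :
  colim_in x = colim_in y <->
  exists K0, forall K, (K0 <= K)%N -> tr n K x = tr m K y.
Proof. by split=> [/eqmodP/asboolP|H]; last exact/eqmodP/asboolP. Qed.

Lemma colim_in_tr n m (x : X n) :
  (n <= m)%N -> colim_in (tr n m x : X m) = colim_in x.
Proof.
move=> nm; apply/colim_in_eq; exists m => K mK.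
by rewrite transition_trans // nm.
Qed.

Lemma colim_inP (c : colim) : exists n (x : X n), c = colim_in x.
Proof.
have := reprK (c : {eq_quot germ_equiv}%qT).
by case: (repr _) => n x <-; exists n, x.
Qed.

Lemma colim_in_ge (c : colim) N :
  exists n (x : X n), (N <= n)%N /\ c = colim_in x.
Proof.
have [n [x ->]] := colim_inP c.
exists (maxn N n), (tr n (maxn N n) x).
by rewrite colim_in_tr ?leq_maxl ?leq_maxr.
Qed.

Lemma colim_in2 (c d : colim) :
  exists n (x y : X n), c = colim_in x /\ d = colim_in y.
Proof.
have [n [x ->]] := colim_inP c; have [m [y [nm ->]]] := colim_in_ge d n.
by exists m, (tr n m x), y; rewrite colim_in_tr.
Qed.

(** Finitely many elements come from a common stage, so the module axioms of
    the colimit are those of the stages. *)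
Lemma colim_in3 (c d e : colim) : exists n (x y z : X n),
  [/\ c = colim_in x, d = colim_in y & e = colim_in z].
Proof.
have [n [x [y [-> ->]]]] := colim_in2 c d.
have [m [z [nm ->]]] := colim_in_ge e n.
by exists m, (tr n m x), (tr n m y), z; rewrite !colim_in_tr.
Qed.

Definition colim_rep (c : colim) : {n & X n} :=
  repr (c : {eq_quot germ_equiv}%qT).

Lemma colim_repP n (x : X n) : exists K0, forall K, (K0 <= K)%N ->
  tr _ K (tagged (colim_rep (colim_in x))) = tr n K x.
Proof.
apply/colim_in_eq; rewrite /colim_in /colim_rep.
have := reprK (\pi_{eq_quot germ_equiv} (Tagged (fun n => X n) x))%qT.
by case: (repr _).
Qed.

(** Operations are computed on representatives brought to a common stage; the
    same pattern serves addition, opposite and scaling, the last two as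
    operations that ignore their second argument. *)
Definition colim_op (op : forall n, X n -> X n -> X n) (c d : colim) : colim :=
  let p := colim_rep c in let q := colim_rep d in
  let k := maxn (tag p) (tag q) in
  colim_in (op k (tr _ k (tagged p)) (tr _ k (tagged q))).

Lemma colim_opE (op : forall n, X n -> X n -> X n) n (x y : X n) :
    (forall n m x y, tr n m (op n x y) = op m (tr n m x) (tr n m y)) ->
  colim_op op (colim_in x) (colim_in y) = colim_in (op n x y).
Proof.
move=> opE; apply/colim_in_eq.
have [K KP] := colim_repP x; have [L LP] := colim_repP y.
set p := colim_rep _ in KP *; set q := colim_rep _ in LP *.
exists (maxn (maxn K L) (maxn (tag p) (tag q))) => k.
rewrite geq_max => /andP[]; rewrite geq_max => /andP[Kk Lk] pqk.
rewrite !opE !transition_trans ?leq_maxl ?leq_maxr //.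
by rewrite KP ?LP.
Qed.

Definition colim_add := colim_op (fun n x y => x + y).
Definition colim_opp c := colim_op (fun n x y => - x) c c.
Definition colim_scale (a : R) c := colim_op (fun n x y => a *: x) c c.
Definition colim_zero := colim_in (0 : X 0%N).

Lemma colim_in_add n (x y : X n) :
  colim_add (colim_in x) (colim_in y) = colim_in (x + y).
Proof. by apply: colim_opE => n' m' x' y'; rewrite raddfD. Qed.
Lemma colim_in_opp n (x : X n) : colim_opp (colim_in x) = colim_in (- x).
Proof.
by apply: (@colim_opE (fun n x y => - x)) => n' m' x' y'; rewrite raddfN.
Qed.
Lemma colim_in_scale a n (x : X n) :
  colim_scale a (colim_in x) = colim_in (a *: x).
Proof.
by apply: (@colim_opE (fun n x y => a *: x)) => n' m' x' y'; rewrite linearZ.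
Qed.
Lemma colim_in_zero n : colim_in (0 : X n) = colim_zero.
Proof. by apply/colim_in_eq; exists 0%N => K _; rewrite !raddf0. Qed.

Fact colim_addA : associative colim_add.
Proof.
move=> c d e; have [n [x [y [z [-> -> ->]]]]] := colim_in3 c d e.
by rewrite !colim_in_add addrA.
Qed.
Fact colim_addC : commutative colim_add.
Proof.
move=> c d; have [n [x [y [-> ->]]]] := colim_in2 c d.
by rewrite !colim_in_add addrC.
Qed.
Fact colim_add0 : left_id colim_zero colim_add.
Proof.
move=> c; have [n [x ->]] := colim_inP c.
by rewrite -(colim_in_zero n) colim_in_add add0r.
Qed.
Fact colim_addN : left_inverse colim_zero colim_opp colim_add.
Proof.
move=> c; have [n [x ->]] := colim_inP c.
by rewrite colim_in_opp colim_in_add addNr colim_in_zero.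
Qed.
HB.instance Definition _ := GRing.isZmodule.Build colim
  colim_addA colim_addC colim_add0 colim_addN.

Fact colim_scaleA a b c :
  colim_scale a (colim_scale b c) = colim_scale (a * b) c.
Proof.
by have [n [x ->]] := colim_inP c; rewrite !colim_in_scale scalerA.
Qed.
Fact colim_scale1 : left_id 1 colim_scale.
Proof.
by move=> c; have [n [x ->]] := colim_inP c; rewrite colim_in_scale scale1r.
Qed.
Fact colim_scaleDr : right_distributive colim_scale +%R.
Proof.
move=> a c d; have [n [x [y [-> ->]]]] := colim_in2 c d.
by rewrite [_ + _]colim_in_add !colim_in_scale [RHS]colim_in_add scalerDr.
Qed.
Fact colim_scaleDl c : {morph colim_scale^~ c : a b / a + b}.
Proof.
move=> a b; have [n [x ->]] := colim_inP c.
by rewrite !colim_in_scale [RHS]colim_in_add scalerDl.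
Qed.
HB.instance Definition _ := GRing.Zmodule_isLmodule.Build R colim
  colim_scaleA colim_scale1 colim_scaleDr colim_scaleDl.

Lemma colim_in_linear n : linear (@colim_in n : X n -> colim).
Proof. by move=> a x y; rewrite -colim_in_add -colim_in_scale. Qed.
HB.instance Definition _ n :=
  GRing.isLinear.Build R (X n) colim _ (@colim_in n) (@colim_in_linear n).

Lemma transition_ge0 n m (x : X n) : 0 <= x -> 0 <= (tr n m x : X m).
Proof.
move=> x0; elim: m => [|m IH] /=; case: eqP => [e|_] //.
- by case: _ / e.
- by case: _ / e.
by apply: linear_homo_ge0 => //; exact: os_homo.
Qed.

Definition colim_le (c d : colim) : bool :=
  `[< exists n (z : X n), 0 <= z /\ d - c = colim_in z >].

Fact colim_le_refl : reflexive colim_le.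
Proof.
by move=> c; apply/asboolP; exists 0%N, 0; rewrite subrr.
Qed.
Lemma colim_pos_pair n m (x : X n) (y : X m) : 0 <= x -> 0 <= y ->
  exists k (x' y' : X k), [/\ 0 <= x', 0 <= y',
    colim_in x = colim_in x' & colim_in y = colim_in y'].
Proof.
move=> x0 y0; pose k := maxn n m; exists k, (tr n k x), (tr m k y).
by rewrite !colim_in_tr ?leq_maxl ?leq_maxr; split=> //; exact: transition_ge0.
Qed.
Fact colim_le_trans : transitive colim_le.
Proof.
move=> d c e /asboolP[n [x [x0 dc]]] /asboolP[m [y [y0 ed]]]; apply/asboolP.
have [k [x' [y' [x'0 y'0 xE yE]]]] := colim_pos_pair x0 y0.
exists k, (y' + x'); split; first exact: og_addr_ge0.
by rewrite raddfD /= -xE -yE -dc -ed addrA subrK.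
Qed.
Fact colim_le_anti : antisymmetric colim_le.
Proof.
move=> c d /andP[/asboolP[n [x [x0 dc]]] /asboolP[m [y [y0 cd]]]].
have [k [x' [y' [x'0 y'0 xE yE]]]] := colim_pos_pair x0 y0.
have /colim_in_eq[K KP] : colim_in (x' + y') = colim_in (0 : X k).
  by rewrite raddfD raddf0 /= -xE -yE -dc -cd addrA subrK subrr.
(* The sum of two positive elements vanishes at some stage, where each of
   them is then zero by antisymmetry of the order there. *)
have := KP _ (leq_maxl K k); set K' := maxn _ _; rewrite raddfD raddf0 => /eqP.
rewrite addr_eq0 => /eqP xy.
have x'K : tr k K' x' = 0.
  apply/le_anti; rewrite transition_ge0 // andbT.
  by rewrite -og_subr_ge0 sub0r xy opprK transition_ge0.
apply/eqP; rewrite eq_sym -subr_eq0 dc xE -(@colim_in_tr k K') ?leq_maxr //.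
by rewrite x'K raddf0.
Qed.
HB.instance Definition _ := Order.Le_isPOrder.Build ring_display colim
  colim_le_refl colim_le_anti colim_le_trans.

Lemma colim_leE (c d : colim) :
  c <= d <-> exists n (z : X n), 0 <= z /\ d - c = colim_in z.
Proof. by split=> [/asboolP|H]; last exact/asboolP. Qed.

Fact colim_leD (e c d : colim) : c <= d -> c + e <= d + e.
Proof.
move=> /colim_leE[n [z [z0 dc]]]; apply/colim_leE; exists n, z.
by rewrite opprD addrACA subrr addr0.
Qed.
Fact colim_leZ (g : gT) (c d : colim) : c <= d -> gelt g *: c <= gelt g *: d.
Proof.
move=> /colim_leE[n [z [z0 dc]]]; apply/colim_leE; exists n, (gelt g *: z).
rewrite -scalerBr dc linearZ; split=> //.
by apply: og_scale_ge0 => //; apply: nonneg_coefU.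
Qed.
HB.instance Definition _ := Lmodule_isOrderedGrpMod.Build gT colim
  colim_leD colim_leZ.

Lemma colim_in_homo n : {homo @colim_in n : x y / x <= y >-> x <= y}.
Proof.
move=> x y xy; apply/colim_leE; exists n, (y - x).
by rewrite og_subr_ge0 raddfB.
Qed.

Lemma colim_ge0 (c : colim) : 0 <= c ->
  exists n (x : X n), 0 <= x /\ c = colim_in x.
Proof. by move=> /colim_leE[n [z]]; rewrite subr0; exists n, z. Qed.

Lemma colim_in_map n : @colim_in n.+1 \o os_map X n =1 @colim_in n.
Proof.
by move=> x /=; rewrite -(@colim_in_tr n n.+1) // transitionS // transition_id.
Qed.

Lemma colim_in_ker n (x : X n) : colim_in x = 0 ->
  exists2 m, (n <= m)%N & tr n m x = 0.
Proof.
rewrite -[0](colim_in_zero n) => /colim_in_eq[K KP].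
by exists (maxn n K); rewrite ?leq_maxl // KP ?leq_maxr // raddf0.
Qed.

End Colimit.

(** * Direct limits in the two categories *)

Section SeqLimit.
Variables (gT : groupType) (X : osys gT).
Local Notation R := (grpring gT).

(** What a sequential limit amounts to on elements; unlike the universal
    property, this is independent of the category in which the limit is
    taken. *)
Record seq_limit (L : ogrpType gT) (phi : forall n, {linear X n -> L}) :
    Prop := SeqLimit {
  sl_homo : forall n, {homo phi n : x y / x <= y};
  sl_map : forall n, phi n.+1 \o os_map X n =1 phi n;
  sl_pos : forall l, 0 <= l -> exists n x, 0 <= x /\ phi n x = l;
  sl_surj : forall l, exists n x, phi n x = l;
  sl_ker : forall n x, phi n x = 0 -> exists2 m, (n <= m)%N &
    transition (X := fun n => X n) (os_map X) n m x = 0 }.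

Lemma colim_seq_limit :
  seq_limit (fun n => @colim_in gT X n : {linear X n -> colim X}).
Proof.
split=> [n|n|l l0|l|n x].
- exact: colim_in_homo.
- exact: colim_in_map.
- by have [n [x [x0 ->]]] := colim_ge0 l0; exists n, x.
- by have [n [x ->]] := colim_inP l; exists n, x.
exact: colim_in_ker.
Qed.

(** An element [l] is the image under [g] of [h l], so lifts of [h l] are lifts
    of [l]; and an element killed by [phi] is killed by [iota]. *)
Lemma seq_limit_retract (C L : ogrpType gT)
    (iota : forall n, {linear X n -> C}) (phi : forall n, {linear X n -> L})
    (h : {linear L -> C}) (g : {linear C -> L}) :
    seq_limit iota ->
    (forall n, {homo phi n : x y / x <= y}) ->
    (forall n, phi n.+1 \o os_map X n =1 phi n) ->
    {homo h : x y / x <= y} ->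
    (forall n, h \o phi n =1 iota n) -> (forall n, g \o iota n =1 phi n) ->
    g \o h =1 id ->
  seq_limit phi.
Proof.
move=> limC phi_homo phif h_homo hphi gin ghK.
split=> // [l l0|l|n x phix].
- have [n [x [x0 hl]]] := sl_pos limC (linear_homo_ge0 h_homo l0).
  by exists n, x; rewrite -gin /= hl [LHS]ghK.
- have [n [x hl]] := sl_surj limC (h l).
  by exists n, x; rewrite -gin /= hl [LHS]ghK.
by apply: (sl_ker limC); rewrite -hphi /= phix raddf0.
Qed.

Lemma colim_order_unit (u : forall n, X n) :
    (forall n, order_unit (u n)) -> (forall n, os_map X n (u n) = u n.+1) ->
  (forall n, colim_in (u n) = colim_in (u 0%N)) /\
  order_unit (colim_in (u 0%N) : (colim X : ogrpType gT)).
Proof.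
move=> uP fu; have inu n : colim_in (u n) = colim_in (u 0%N).
  by elim: n => [|n IH] //; rewrite -IH -[in RHS](@colim_in_map gT X n) /= fu.
split=> //; split.
  exact: linear_homo_ge0 (@colim_in_homo gT X 0%N) _ (uP 0%N).1.
move=> c; have [n [x ->]] := colim_inP c.
have [a [a0 a_ge0 xa]] := (uP n).2 x.
by exists a; split=> //; rewrite -(inu n) -linearZ; exact: colim_in_homo.
Qed.

Local Notation tr := (transition (X := fun n => X n) (os_map X)).

Definition colim_interval (I : forall n, set (X n)) : set (colim X) :=
  [set c | exists n (x : X n), I n x /\ c = colim_in x]%classic.

(** All conditions concern finitely many elements and finitely many
    inequalities between them, which already hold at some stage. *)
Lemma colim_generating_interval (I : forall n, set (X n)) :
    (forall n, generating_interval (I n)) ->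
    (forall n x, I n x -> I n.+1 (os_map X n x)) ->
  generating_interval (colim_interval I : set (colim X : ogrpType gT)).
Proof.
move=> IP fI.
have I_tr n m (x : X n) : (n <= m)%N -> I n x -> I m (tr n m x).
  by move=> nm xI; apply: (transition_ind (P := I)) nm.
have I2 c d : colim_interval I c -> colim_interval I d ->
    exists n (x y : X n), [/\ I n x, I n y, c = colim_in x & d = colim_in y].
  move=> [n [x [xI ->]]] [m [y [yI ->]]]; pose k := maxn n m.
  exists k, (tr n k x), (tr m k y).
  by rewrite !colim_in_tr ?leq_maxl ?leq_maxr; split=> //; apply: I_tr;
    rewrite ?leq_maxl ?leq_maxr.
split.
- exists 0%N, 0; split; last by rewrite raddf0.
  by have [] := IP 0%N.
- move=> c [n [x [xI ->]]].
  apply: linear_homo_ge0 (@colim_in_homo gT X n) _ _.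
  by have [_ + _ _ _] := IP n; apply.
- move=> c d Ic Id; have [n [x [y [xI yI -> ->]]]] := I2 c d Ic Id.
  have [_ _ dirI _ _] := IP n.
  have [z [zI xz yz]] := dirI x y xI yI.
  exists (colim_in z).
  by split; [exists n, z | exact: colim_in_homo..].
- move=> c d e Ic Id ce ed; have [n [x [y [xI yI cE dE]]]] := I2 c d Ic Id.
  have ec0 : 0 <= e - c by rewrite og_subr_ge0.
  have de0 : 0 <= d - e by rewrite og_subr_ge0.
  have [p [s [s0 sE]]] := colim_ge0 ec0.
  have [q [t [t0 tE]]] := colim_ge0 de0.
  (* Both inequalities are equalities up to the positive elements [s] and [t];
     they hold at a stage [m] where their sum [y - x = s + t] does. *)
  pose k := maxn n (maxn p q).
  have nk : (n <= k)%N by rewrite leq_maxl.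
  have pk : (p <= k)%N by rewrite /k maxnCA leq_maxl.
  have qk : (q <= k)%N by rewrite /k (maxnC p) maxnCA leq_maxl.
  have : colim_in (tr n k y - tr n k x - tr p k s - tr q k t : X k) = 0.
    rewrite !raddfB /= !colim_in_tr // -cE -dE -sE -tE.
    by rewrite opprB addrA subrK opprB addrA subrK subrr.
  move=> /colim_in_ker[m km]; rewrite !raddfB /=.
  rewrite !transition_trans ?nk ?pk ?qk // => /eqP; rewrite subr_eq0 => /eqP yE.
  exists m, (tr n m x + tr p m s); split; last first.
    rewrite raddfD /= !colim_in_tr ?(leq_trans nk) ?(leq_trans pk) //.
    by rewrite -cE -sE addrC subrK.
  have [_ _ _ convI _] := IP m.
  apply: (convI (tr n m x) (tr n m y)).
  + by apply: I_tr => //; apply: leq_trans km.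
  + by apply: I_tr => //; apply: leq_trans km.
  + by rewrite -og_subr_ge0 addrAC subrr add0r; apply: transition_ge0.
  by rewrite -og_subr_ge0 opprD addrA yE; apply: transition_ge0.
move=> c /colim_ge0[n [x [x0 ->]]].
have [_ _ _ _ genI] := IP n.
have [k [a [d [a0 dI ->]]]] := genI x x0.
exists k, a, (fun i => colim_in (d i)); split=> // [i|].
  by exists n, (d i).
by rewrite raddf_sum; apply: eq_bigr => i _; rewrite /= linearZ.
Qed.

End SeqLimit.

Section UniversalProperty.
Variables (gT : groupType) (Obj : Type) (grp : Obj -> ogrpType gT).
Variable hom : forall A B : Obj, {linear grp A -> grp B} -> Prop.
Hypothesis hom_homo : forall A B (f : {linear grp A -> grp B}),
  hom f -> {homo f : x y / x <= y}.
Hypothesis hom_id : forall A, hom (idfun : {linear grp A -> grp A}).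
Hypothesis hom_comp : forall A B C (g : {linear grp B -> grp C})
  (f : {linear grp A -> grp B}), hom g -> hom f -> hom (A := A) (g \o f).

(** A universal cocone [phi] has the elementwise description as soon as some
    object [C] of the category does. Universality gives [h] from [L] to [C];
    the elementwise description of [C] gives [g] back, and uniqueness of
    factorizations makes [g] a retraction of [h]. *)
Lemma universal_seq_limit (X : nat -> Obj)
    (f : forall n, {linear grp (X n) -> grp (X n.+1)})
    (f_homo : forall n, {homo f n : x y / x <= y})
    (C L : Obj)
    (iota : forall n, {linear grp (X n) -> grp C})
    (phi : forall n, {linear grp (X n) -> grp L}) :
    seq_limit (X := OSys f_homo) iota ->
    cocone (mod_of := fun A => grp A) hom f iota ->
    cocone (mod_of := fun A => grp A) hom f phi ->
    (forall g : {linear grp C -> grp L},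
       (forall n, g \o iota n =1 phi n) -> hom g) ->
    (forall (M : Obj) (psi : forall n, {linear grp (X n) -> grp M}),
       cocone (mod_of := fun A => grp A) hom f psi ->
       exists h : {linear grp L -> grp M},
         [/\ hom h, forall n, h \o phi n =1 psi n &
             forall h' : {linear grp L -> grp M},
               hom h' -> (forall n, h' \o phi n =1 psi n) -> h' =1 h]) ->
  seq_limit (X := OSys f_homo) phi.
Proof.
move=> limC cocC cocL homC univ; have [phihom phif] := cocL.
have [h [hhom hphi _]] := univ C iota cocC.
have [g gin] := colimit_factor (sl_map limC) phif (sl_surj limC) (sl_ker limC).
have ghom := homC g gin.
(* [g \o h] and the identity are both morphisms from [L] to [L] compatible
   with [phi], hence equal. *)
have [h0 [_ _ uniq]] := univ L phi cocL.
apply: (seq_limit_retract (h := h) (g := g) limC) => // [n||l].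
- exact: hom_homo.
- exact: hom_homo.
transitivity (h0 l).
  apply: (uniq (g \o h)) => [|n x]; first exact: hom_comp.
  by rewrite /= [h _]hphi [LHS]gin.
by symmetry; apply: (uniq idfun) => // n x.
Qed.

End UniversalProperty.

Section DirectLimits.
Variable gT : groupType.

Lemma colim_lin_homo (X : osys gT) (L : ogrpType gT)
    (phi : forall n, {linear X n -> L}) (g : {linear colim X -> L}) :
    (forall n, {homo phi n : x y / x <= y}) ->
    (forall n, g \o @colim_in gT X n =1 phi n) ->
  {homo g : x y / x <= y}.
Proof.
move=> phi_homo gin; apply: linear_homo => c /colim_ge0[n [x [x0 ->]]].
by rewrite [g _]gin; apply: linear_homo_ge0 (phi_homo n) _ x0.
Qed.

Lemma unital_direct_limit (X : nat -> unitalGroup gT) (L : unitalGroup gT) :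
    direct_limit (mod_of := fun A : unitalGroup gT => A) (@unital_hom gT) X L ->
  exists (f : forall n, {linear X n -> X n.+1})
    (f_homo : forall n, {homo f n : x y / x <= y})
    (phi : forall n, {linear X n -> L}), seq_limit (X := OSys f_homo) phi.
Proof.
move=> [f [phi [fhom [phihom phif] univ]]].
pose f_homo n := (fhom n).1; exists f, f_homo, phi.
pose Y := OSys f_homo.
have [inu uP] := colim_order_unit (X := Y) (fun n => ug_unitP (X n))
  (fun n => (fhom n).2).
pose C := UnitalGroup uP.
pose iota : forall n, {linear X n -> C} :=
  fun n => (@colim_in gT Y n : {linear Y n -> colim Y}).
apply: (@universal_seq_limit gT _ (@ug_group gT) (@unital_hom gT) _ _ _
  X f f_homo C L iota phi) => //.
- by move=> A B ? [].
- by move=> A; split.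
- move=> A B D g h [gh gu] [hh hu]; split=> [x y /hh/gh //|].
  by rewrite /= hu gu.
- exact: (colim_seq_limit Y).
- split=> n; last exact: (@colim_in_map gT Y).
  by split; [exact: (@colim_in_homo gT Y) | exact: inu].
move=> g gin; split; last by rewrite -(phihom 0%N).2; apply: (gin 0%N).
exact: (@colim_lin_homo Y L phi g (fun n => (phihom n).1)).
Qed.

Lemma interval_direct_limit (X : nat -> intervalGroup gT)
    (L : intervalGroup gT) :
    direct_limit (mod_of := fun A : intervalGroup gT => A)
      (@interval_hom gT) X L ->
  exists (f : forall n, {linear X n -> X n.+1})
    (f_homo : forall n, {homo f n : x y / x <= y})
    (phi : forall n, {linear X n -> L}), seq_limit (X := OSys f_homo) phi.
Proof.
move=> [f [phi [fhom [phihom phif] univ]]].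
pose f_homo n := (fhom n).1; exists f, f_homo, phi.
pose Y := OSys f_homo.
have IP := colim_generating_interval (X := Y) (fun n => ig_intervalP (X n))
  (fun n => (fhom n).2).
pose C := IntervalGroup IP.
pose iota : forall n, {linear X n -> C} :=
  fun n => (@colim_in gT Y n : {linear Y n -> colim Y}).
apply: (@universal_seq_limit gT _ (@ig_group gT) (@interval_hom gT) _ _ _
  X f f_homo C L iota phi) => //.
- by move=> A B ? [].
- by move=> A; split.
- by move=> A B D g h [gh gI] [hh hI]; split=> [x y /hh/gh|x /hI/gI].
- exact: (colim_seq_limit Y).
- split=> n; last exact: (@colim_in_map gT Y).
  by split; [exact: (@colim_in_homo gT Y) | move=> x xI; exists n, x].
move=> g gin; split; last first.
  by move=> c [n [x [xI ->]]]; rewrite [g _]gin; apply: (phihom n).2.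
exact: (@colim_lin_homo Y L phi g (fun n => (phihom n).1)).
Qed.

End DirectLimits.

(** * Ultrasimplicial groups are countable dimension groups *)

Section SimplicialGroups.
Variables (gT : groupType) (D : groupClosed gT).
Local Notation R := (grpring gT).

(** Uniform access to the two cases of the definition: the zero group is
    treated as having the empty basis, and coefficients are normalized to be
    nonnegative in the group ring itself rather than modulo [D]. *)
Lemma simplicial_span (G : ogrpType gT) : simplicial D G ->
  exists (k : nat) (x : 'I_k -> G),
    [/\ simplicial_basis D x,
        (forall z : G, 0 <= z -> exists a : 'I_k -> R,
           (forall i, nonneg_coef (a i)) /\ z = \sum_i a i *: x i),
        (forall i, 0 <= x i) &
        (forall z : G, exists a : 'I_k -> R, z = \sum_i a i *: x i)].
Proof.
case=> [[k [x [xP cone dirG]]]|G0]; last first.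
  exists 0%N, (fun=> 0); split=> [|z _|[]|z] //.
  - by split=> [[]//|a b _ _]; split=> [_ []|_] //; rewrite !big_ord0.
  - by exists (fun=> 0); split=> [[]|]//; rewrite big_ord0; exact: G0.
  by exists (fun=> 0); rewrite big_ord0; exact: G0.
have span z : 0 <= z -> exists a : 'I_k -> R,
    (forall i, nonneg_coef (a i)) /\ z = \sum_i a i *: x i.
  move=> /cone[a [a0]]; rewrite subr0 => zE.
  exists (fun i => coset_lift (coset_proj D (a i))); split=> [i|].
    exact: nonneg_coset_lift.
  rewrite zE; apply: eq_bigr => i _; rewrite coset_proj_lift_act //.
  by move=> g gD; apply/xP.1.
exists k, x; split=> // [i|z].
  apply/cone; exists (fun j => if j == i then 1 else 0); split=> [j|].
    apply: nonneg_coset_proj; case: ifP => _; last exact: nonneg_coef0.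
    exact: nonneg_coefU.
  rewrite subr0 (bigD1 i) //= eqxx scale1r big1 ?addr0 // => j /negPf ->.
  by rewrite scale0r.
have [p [q [/span[a [_ ->]] /span[b [_ ->]] ->]]] := og_directed_split dirG z.
exists (fun i => a i - b i); rewrite -sumrB.
by apply: eq_bigr => i _; rewrite scalerBl.
Qed.

(** Freeness is given for coefficients in the cone only; arbitrary coefficients
    reduce to it as differences of nonnegative ones. *)
Lemma simplicial_basis_indep (G : lmodType R) k (x : 'I_k -> G)
    (c : 'I_k -> R) :
  simplicial_basis D x -> \sum_i c i *: x i = 0 ->
  forall i, coset_proj D (c i) = 0.
Proof.
move=> xP c0 i.
have /choice[p pP] j := nonneg_coef_split (c j).
have {pP}/choice[q pqP] := pP.
have cE j : c j = p j - q j by have [] := pqP j.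
rewrite cE; move: i; apply/xP.2 => [j|j|].
- by apply: nonneg_coset_proj; have [] := pqP j.
- by apply: nonneg_coset_proj; have [] := pqP j.
apply/eqP; rewrite -subr_eq0 -sumrB -[X in _ == X]c0; apply/eqP.
by apply: eq_bigr => j _; rewrite cE scalerBl.
Qed.

Lemma simplicial_SDP (G : ogrpType gT) : simplicial D G -> SDP D G.
Proof.
move=> /simplicial_span[k [x [xP span x0 _]]] n a z z0 az0.
have /choice[c cP] i := span (z i) (z0 i).
(* The basis itself is the required family; a zero element in position [ord0]
   keeps it nonempty when [k] is 0. *)
exists k.+1, (fun i j => oapp (c i) 0 (unlift ord0 j)),
  (fun j => oapp x 0 (unlift ord0 j)).
split=> // [i j|j|i|j].
- by case: unliftP => [l _|_] /=; [exact: (cP i).1 | exact: nonneg_coef0].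
- by case: unliftP => [l _|_] /=; [exact: x0 | exact: lexx].
- rewrite big_ord_recl unlift_none scale0r add0r (cP i).2.
  by apply: eq_bigr => l _; rewrite liftK.
case: unliftP => [l _|_] /=; last first.
  by rewrite big1 // => i _; rewrite mulr0 coset_proj0.
rewrite -coset_proj_sum; move: l; apply: (simplicial_basis_indep xP).
rewrite -[RHS]az0.
under eq_bigr => l _ do rewrite scaler_suml.
rewrite exchange_big; apply: eq_bigr => i _ /=.
rewrite (cP i).2 scaler_sumr.
by apply: eq_bigr => l _; rewrite scalerA.
Qed.

Lemma simplicial_trivial (abel : forall g h : gT, commute g h)
    (G : ogrpType gT) : simplicial D G -> forall z : G, trivial_on D z.
Proof.
move=> /simplicial_span[k [x [xP _ _ span]]] z g gD.
have [a ->] := span z; rewrite scaler_sumr; apply: eq_bigr => i _.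
rewrite scalerA (grpring_mulC abel) -scalerA; congr (_ *: _).
exact/(xP.1 i g).
Qed.

End SimplicialGroups.

Section LimitSDP.
Variables (gT : groupType) (X : osys gT) (L : ogrpType gT).
Variable phi : forall n, {linear X n -> L}.
Hypothesis limL : seq_limit phi.
Local Notation tr := (transition (X := fun n => X n) (os_map X)).

Lemma seq_limit_lift k (x : 'I_k -> L) : (forall i, 0 <= x i) ->
  exists n (y : 'I_k -> X n),
    (forall i, 0 <= y i) /\ forall i, phi n (y i) = x i.
Proof.
move=> x0.
have /choice[t tP] i : exists t : {n & X n},
    0 <= tagged t /\ phi (tag t) (tagged t) = x i.
  have [n [y yP]] := sl_pos limL (x0 i).
  by exists (Tagged (fun n => X n) y).
exists (\max_i tag (t i)), (fun i => tr _ _ (tagged (t i))).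
split=> i; first exact/transition_ge0/(tP i).1.
rewrite (transition_cocone (sl_map limL)) ?(tP i).2 //.
exact: leq_bigmax.
Qed.

(** The relation lifts to some stage up to an element of the kernel, hence
    holds exactly at a later one, where it can be decomposed. *)
Lemma seq_limit_SDP (D : groupClosed gT) :
  (forall n, SDP D (X n)) -> SDP D L.
Proof.
move=> sdp k a x x0 ax0; have [n [y [y0 yE]]] := seq_limit_lift x0.
have [|m nm] := sl_ker limL (x := \sum_i a i *: y i).
  rewrite linear_sum -[RHS]ax0; apply: eq_bigr => i _.
  by rewrite linearZ /= yE.
rewrite linear_sum /= => ay0.
have [||r [b [w [r0 b0 w0 yb ab]]]] :=
  sdp m k a (fun i => tr n m (y i) : X m).
- by move=> i; apply: transition_ge0.
- by rewrite -[RHS]ay0; apply: eq_bigr => i _; rewrite linearZ.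
exists r, b, (fun j => phi m (w j)); split=> // [j|i].
  exact: (linear_homo_ge0 (@sl_homo _ _ _ _ limL m)).
rewrite -yE -(transition_cocone (sl_map limL) (y i) nm) [tr _ _ _]yb linear_sum.
by apply: eq_bigr => j _; rewrite linearZ.
Qed.

End LimitSDP.

Section Enumerations.

Definition enumerated (T : Type) : Prop :=
  exists e : nat -> T, forall t, exists n, e n = t.

Lemma enumerated_from (C : countType) (T : Type) (t0 : T) (e : C -> T) :
  (forall t, exists c, e c = t) -> enumerated T.
Proof.
move=> eP; exists (fun n => oapp e t0 (choice.unpickle n)) => t.
by have [c <-] := eP t; exists (choice.pickle c); rewrite choice.pickleK.
Qed.

Lemma enumerated_countable (T : Type) :
  enumerated T -> countable [set: T]%classic.
Proof.
move=> [e /choice[n nP]]; apply/countable_injP; exists n => s t _ _ nst.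
by rewrite -[s]nP -[t]nP nst.
Qed.

Lemma countable_enumerated (T : Type) (t0 : T) :
  countable [set: T]%classic -> enumerated T.
Proof.
move=> /countable_injP[f f_inj].
have /choice[e eP] n : exists t, forall s, f s = n -> t = s.
  have [[t <-]|none] := pselect (exists t, f t = n).
    by exists t => s st; apply: f_inj; rewrite ?in_setT.
  by exists t0 => s st; case: none; exists s.
by exists e => t; exists (f t); exact: eP.
Qed.

Variable gT : groupType.

(** The values of the words in the generators and their inverses form a
    subgroup that contains the generators. *)
Lemma finitely_generated_enumerated :
  finitely_generated gT -> enumerated gT.
Proof.
move=> [S genS]; pose letter (l : bool * nat) : gT :=
  if l.1 then (nth 1%g S l.2)^-1%g else nth 1%g S l.2.
pose ev (w : seq (bool * nat)) : gT := foldr (fun l g => letter l * g)%g 1%g w.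
have ev_cat w w' : ev (w ++ w') = (ev w * ev w')%g.
  by elim: w => [|l w IH] /=; rewrite ?mul1g // IH mulgA.
have ev_inv w : exists w', ev w' = (ev w)^-1%g.
  elim: w => [|l w [w' IH]]; first by exists [::]; rewrite /= invg1.
  exists (w' ++ [:: (~~ l.1, l.2)]); rewrite ev_cat IH /= mulg1 invgM.
  by congr (_ * _)%g; rewrite /letter /=; case: l.1; rewrite ?invgK.
pose H : {pred gT} := [pred g | `[< exists w, ev w = g >]].
have HP g : reflect (exists w, ev w = g) (g \in H) by exact: asboolP.
have H1 : 1%g \in H by apply/HP; exists [::].
have HM : {in H &, forall x y, (x * y)%g \in H}.
  by move=> x y /HP[w <-] /HP[w' <-]; apply/HP; exists (w ++ w').
have HV : {in H, forall x, x^-1%g \in H}.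
  by move=> x /HP[w <-]; apply/HP; exact: ev_inv.
pose HG : groupClosed gT := HB.pack H (isMul1Closed.Build _ H H1)
  (isMulClosed.Build _ H HM) (isInvClosed.Build _ H HV).
apply: (@enumerated_from _ _ 1%g ev) => g; apply/HP.
apply: (genS HG) => s sS; apply/HP.
by exists [:: (false, index s S)]; rewrite /= mulg1 /letter /= nth_index.
Qed.

Lemma grpring_enumerated : enumerated gT -> enumerated (grpring gT).
Proof.
move=> [e eP]; pose ev (w : seq (int * nat)) : grpring gT :=
  \sum_(l <- w) << l.1 *g e l.2 >>.
apply: (@enumerated_from _ _ 0 ev) => a.
elim/malg_indD: a => [|a b [w <-] [w' <-]|m g].
- by exists [::]; rewrite /ev big_nil.
- by exists (w ++ w'); rewrite /ev big_cat.
by have [n <-] := eP g; exists [:: (m, n)]; rewrite /ev big_seq1.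
Qed.

End Enumerations.

Lemma span_enumerated (gT : groupType) (M : lmodType (grpring gT)) k
    (x : 'I_k -> M) :
    enumerated gT ->
    (forall z, exists a : 'I_k -> grpring gT, z = \sum_i a i *: x i) ->
  enumerated M.
Proof.
move=> /grpring_enumerated[e eP] span.
apply: (@enumerated_from _ _ 0
  (fun s : seq nat => \sum_(i < k) e (nth 0%N s i) *: x i)) => z.
have [a ->] := span z; have /choice[c cP] i := eP (a i).
exists [seq c i | i <- enum 'I_k]; apply: eq_bigr => i _.
by rewrite (nth_map i) ?size_enum_ord // nth_ord_enum cP.
Qed.

Lemma seq_limit_enumerated (gT : groupType) (D : groupClosed gT) (X : osys gT)
    (L : ogrpType gT) (phi : forall n, {linear X n -> L}) :
  enumerated gT -> (forall n, simplicial D (X n)) -> seq_limit phi ->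
  enumerated L.
Proof.
move=> gT_enum simpX limL.
have /all_sig[e eP] n : {e : nat -> X n | forall z, exists c, e c = z}.
  apply: cid; have [k [x [_ _ _ span]]] := simplicial_span (simpX n).
  exact: span_enumerated gT_enum span.
apply: (@enumerated_from _ _ 0 (fun p : nat * nat => phi p.1 (e p.1 p.2))) => l.
have [n [z <-]] := sl_surj limL l; have [c <-] := eP n z.
by exists (n, c).
Qed.

Lemma ultrasimplicial_seq_limit (gT : groupType) (G : ogrpType gT) :
  ultrasimplicial G -> directed G /\
  exists (D : groupClosed gT) (X : osys gT) (phi : forall n, {linear X n -> G}),
    (forall n, simplicial D (X n)) /\ seq_limit phi.
Proof.
move=> [dirG [[u [uP [D [X [simpX]]]]]|[I [IP [D [X [simpX _]]]]]]].
  move=> /unital_direct_limit[f [f_homo [phi limG]]].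
  by split=> //; exists D, (OSys f_homo), phi.
move=> /interval_direct_limit[f [f_homo [phi limG]]].
by split=> //; exists D, (OSys f_homo), phi.
Qed.

Lemma ultrasimplicial_dimension (gT : groupType)
    (abel : forall g h : gT, commute g h) (fg : finitely_generated gT)
    (G : ogrpType gT) :
  ultrasimplicial G -> countable [set: G]%classic /\ dimension_group G.
Proof.
move=> /ultrasimplicial_seq_limit[dirG [D [X [phi [simpX limG]]]]]; split.
  apply/enumerated_countable/(seq_limit_enumerated _ simpX limG).
  exact: finitely_generated_enumerated.
split=> //; exists D; split.
  move=> g gD x; have [n [y <-]] := sl_surj limG x.
  by rewrite -linearZ /= (simplicial_trivial abel (simpX n)).
by apply: (seq_limit_SDP limG) => n; apply: simplicial_SDP.
Qed.

(** * Countable dimension groups are ultrasimplicial *)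

Section Intervals.
Variable gT : groupType.

Lemma positive_cone_interval (G : ogrpType gT) :
  directed G -> generating_interval [set x : G | 0 <= x]%classic.
Proof.
move=> dirG; split=> //= [x y x0 y0|x y z x0 _ xz _|x x0].
- have [z [xz yz]] := dirG x y; exists z; split=> //.
  exact: le_trans x0 xz.
- exact: le_trans x0 xz.
exists 1%N, (fun=> 1), (fun=> x); split=> // [_|].
  exact: nonneg_coefU.
by rewrite big_ord1 scale1r.
Qed.

Variables (D : groupClosed gT) (k : nat) (u : permpow D k).
Hypotheses (u0 : 0 <= u) (gen_u : forall i, permpow_gen D i <= u).

(** A vector [z >= 0] is a combination of generators with nonnegative
    coefficients [c i], hence at most [(\sum_i c i) u]; adding 1 makes the
    multiplier nonzero. *)
Lemma permpow_order_unit : order_unit (u : (permpow D k : ogrpType gT)).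
Proof.
split=> // v.
have [z [vz z0]] := @permpow_directed gT D k v 0.
pose c i := coset_lift (z i); pose a : grpring gT := 1 + \sum_i c i.
have c_ge0 i : nonneg_coef (c i).
  by apply/nonneg_coset_lift; move: i; apply/permpow_ge0.
have s_ge0 : nonneg_coef (\sum_i c i : grpring gT).
  by elim/big_rec: _ => [|i b _]; [exact: nonneg_coef0 | exact: nonneg_coefD].
exists a; split.
- apply/eqP => /malgP/(_ 1%g) /eqP; rewrite mcoeffD mcoeff0.
  rewrite mcoeffUU gt_eqF //.
  by apply: ltr_wpDr; [exact: s_ge0 | exact: ltr01].
- by apply: nonneg_coefD => //; apply: nonneg_coefU.
apply: le_trans vz _; rewrite [z]permpow_gen_span scalerDl scale1r scaler_suml.
rewrite -[X in X <= _]add0r; apply: og_lerD => //.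
rewrite -og_subr_ge0 -sumrB; apply: og_sum_ge0 => i; rewrite -scalerBr.
by apply: og_scale_ge0; rewrite ?og_subr_ge0.
Qed.

Lemma permpow_interval :
  generating_interval (order_interval (u : (permpow D k : ogrpType gT))).
Proof.
rewrite /order_interval; split=> /=.
- by rewrite lexx.
- by move=> x /andP[].
- by move=> x y /andP[_ xu] /andP[_ yu]; exists u; rewrite u0 lexx.
- move=> x y z /andP[x0 _] /andP[_ yu] xz zy.
  by rewrite (le_trans x0 xz) (le_trans zy yu).
move=> x x0; exists k, (fun i => coset_lift (x i)), (@permpow_gen gT D k).
split=> [i|i|]; last exact: permpow_gen_span.
  by apply/nonneg_coset_lift; move: i; apply/permpow_ge0.
by rewrite permpow_gen_ge0 gen_u.
Qed.

End Intervals.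

(** Converse of [interval_direct_limit]: the elementwise description implies
    the universal property, provided that the interval of [L] is the union of
    the images of the intervals of the stages. *)
Lemma seq_limit_interval (gT : groupType) (X : nat -> intervalGroup gT)
    (L : intervalGroup gT) (f : forall n, {linear X n -> X n.+1})
    (f_homo : forall n, {homo f n : x y / x <= y})
    (phi : forall n, {linear X n -> L}) :
    seq_limit (X := OSys f_homo) phi ->
    (forall n x, ig_interval x -> ig_interval (f n x)) ->
    (forall n x, ig_interval x -> ig_interval (phi n x)) ->
    (forall l : L, ig_interval l ->
       exists n (x : X n), ig_interval x /\ phi n x = l) ->
  direct_limit (mod_of := fun A : intervalGroup gT => A)
    (@interval_hom gT) X L.
Proof.
move=> limL fI phiI liftI; exists f, phi; split=> [n||M psi [psihom psif]].
- by split; [exact: f_homo | exact: fI].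
- split=> n; last exact: (sl_map limL).
  by split; [exact: (sl_homo limL) | exact: phiI].
have [h hphi] := colimit_factor (sl_map limL) psif (sl_surj limL) (sl_ker limL).
exists h; split=> // [|h' _ h'phi l].
  split=> [|l /liftI[n [x [xI <-]]]].
    apply: linear_homo => l /(sl_pos limL)[n [x [x0 <-]]].
    by rewrite [h _]hphi; apply: linear_homo_ge0 (psihom n).1 _ x0.
  by rewrite [h _]hphi; apply: (psihom n).2.
have [n [x <-]] := sl_surj limL l.
by rewrite [LHS]h'phi [RHS]hphi.
Qed.

Section Construction.
Variables (gT : groupType) (abel : forall g h : gT, commute g h).
Variables (G : ogrpType gT) (D : groupClosed gT).
Hypotheses (D_stab : forall g, g \in D -> stab G g) (sdp : SDP D G).

(** The step of the construction. One decomposition of the images of the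
    generators together with [g] kills [r] and reaches [g] at the same time:
    the coefficients of the decomposition define [f], its elements define
    [psi], and the vanishing of the relation modulo [D] is the equation
    [f r = 0]. *)
Lemma stage_extension k (phi : {linear permpow D k -> G}) (r : permpow D k)
    (g : G) :
    {homo phi : x y / x <= y} -> 0 <= g ->
  exists l (f : {linear permpow D k -> permpow D l})
    (psi : {linear permpow D l -> G}),
    [/\ {homo f : x y / x <= y}, {homo psi : x y / x <= y},
        psi \o f =1 phi, phi r = 0 -> f r = 0 &
        exists2 z, 0 <= z & psi z = g].
Proof.
move=> phi_homo g0.
(* The relation carried by [r], or the trivial one if [phi r] is nonzero;
   [g] takes part with coefficient 0, in position [ord0]. *)
pose r' := if phi r == 0 then r else 0.
have r'0 : phi r' = 0 by rewrite /r'; case: eqP => // _; rewrite raddf0.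
pose a (i : 'I_k.+1) : grpring gT :=
  if unlift ord0 i is Some j then coset_lift (r' j) else 0.
pose x (i : 'I_k.+1) : G :=
  if unlift ord0 i is Some j then phi (permpow_gen D j) else g.
have x0 i : 0 <= x i.
  rewrite /x; case: unlift => [j|] //.
  exact: linear_homo_ge0 phi_homo _ (permpow_gen_ge0 D j).
have ax : \sum_i a i *: x i = 0.
  rewrite big_ord_recl /a unlift_none scale0r add0r -[RHS]r'0 permpow_linE.
  by apply: eq_bigr => j _; rewrite /x liftK.
have [l [b [y [_ b0 y0 xE ab]]]] := sdp x0 ax.
have [f fE] := @permpow_ext gT D k (permpow D l : lmodType _)
  (fun i => \sum_j b (lift ord0 i) j *: permpow_gen D j)
  (fun i => permpow_trivial abel _).
have [psi psiE] := @permpow_ext gT D l G y (fun j g gD => D_stab gD (y j)).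
exists l, f, psi; split.
- apply/linear_homo/permpow_lin_ge0 => i; rewrite fE; apply: og_sum_ge0 => j.
  exact/og_scale_ge0/permpow_gen_ge0.
- by apply/linear_homo/permpow_lin_ge0 => j; rewrite psiE.
- apply: permpow_lin_eq => i; rewrite /= fE linear_sum /=.
  transitivity (x (lift ord0 i)); last by rewrite /x liftK.
  by rewrite xE; apply: eq_bigr => j _; rewrite linearZ /= psiE.
- move=> /eqP phir; have r'E : r' = r by rewrite /r' phir.
  apply/ffunP => j; rewrite ffunE -(ab j) big_ord_recl {1}/a unlift_none.
  rewrite mul0r coset_proj0 add0r permpow_linE sum_ffunE; apply: eq_bigr => i _.
  by rewrite ffunE fE permpow_combE coset_projM /a liftK r'E.
exists (\sum_j b ord0 j *: permpow_gen D j).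
  by apply: og_sum_ge0 => j; apply/og_scale_ge0/permpow_gen_ge0.
transitivity (x ord0); last by rewrite /x unlift_none.
by rewrite xE linear_sum; apply: eq_bigr => j _; rewrite linearZ /= psiE.
Qed.

(** A finite stage of the construction. The value of [st_pending] at [m] and
    [c] is the image, at this stage, of the [c]-th element of stage [m], when
    stage [m] has been built; it keeps track of the elements whose turn to be
    killed is still to come. As [st_unit] bounds the generators, it is an
    order-unit. *)
Record stage := Stage {
  st_dim : nat;
  st_map : {linear permpow D st_dim -> G};
  st_unit : permpow D st_dim;
  st_pending : nat -> nat -> permpow D st_dim;
  st_homo : {homo st_map : x y / x <= y};
  st_unit_ge0 : 0 <= st_unit;
  st_unit_gen : forall i, permpow_gen D i <= st_unit }.

Variables (enum : forall k, nat -> permpow D k) (target : nat -> G).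
Hypothesis target_ge0 : forall n, 0 <= target n.

(** Step [n] takes care of the pending element indexed by the exponents of 2
    and 3 in [n]. The pair [(m, c)] is thus treated at step [2 ^ m * 3 ^ c],
    which comes no earlier than stage [m]. The unit of [t] bounds the image of
    the unit of [s] and a preimage of [target n], so that the intervals of the
    stages exhaust the positive cone of [G]. *)
Definition next_stage (n : nat) (s t : stage) : Prop :=
  exists f : {linear permpow D (st_dim s) -> permpow D (st_dim t)},
    [/\ [/\ {homo f : x y / x <= y}, st_map t \o f =1 st_map s &
            f (st_unit s) <= st_unit t],
        (let r := st_pending s (logn 2 n) (logn 3 n) in
         st_map s r = 0 -> f r = 0),
        (exists2 z, 0 <= z <= st_unit t & st_map t z = target n) &
        forall m c, st_pending t m c =
          if m == n.+1 then @enum (st_dim t) c else f (st_pending s m c)].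

Lemma next_stage_exists n s : exists t, next_stage n s t.
Proof.
pose r := st_pending s (logn 2 n) (logn 3 n).
have [l [f [psi [f_homo psi_homo psif fr [z z0 psiz]]]]] :=
  stage_extension r (@st_homo s) (target_ge0 n).
pose w : permpow D l := \sum_i permpow_gen D i.
have w0 : 0 <= w by apply: og_sum_ge0 => i; apply: permpow_gen_ge0.
have gen_w i : permpow_gen D i <= w.
  rewrite -og_subr_ge0 /w (bigD1 i) //= addrAC subrr add0r.
  by rewrite big_mkcond; apply: og_sum_ge0 => j; case: ifP => _;
    rewrite ?lexx ?permpow_gen_ge0.
have fu0 : 0 <= f (st_unit s).
  exact: linear_homo_ge0 f_homo _ (st_unit_ge0 s).
pose u := f (st_unit s) + z + w.
have u0 : 0 <= u by rewrite !og_addr_ge0.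
have uP i : permpow_gen D i <= u.
  by rewrite -[X in X <= _]add0r; apply: og_lerD => //; apply: og_addr_ge0.
pose pend m c := if m == n.+1 then @enum l c else f (st_pending s m c).
exists (@Stage l psi u pend psi_homo u0 uP), f; split=> //.
  by split=> //=; rewrite /u -addrA -og_subr_ge0 addrAC subrr add0r og_addr_ge0.
exists z => //=; rewrite z0 /= /u addrAC -og_subr_ge0 addrK.
exact: og_addr_ge0.
Qed.

Lemma permpow_dim0 (v : permpow D 0) : v = 0.
Proof. by apply/ffunP => -[]. Qed.

Lemma initial_stage_exists : exists s : stage,
  forall m c, st_pending s m c = @enum (st_dim s) c.
Proof.
have [phi _] := @permpow_ext gT D 0 G (fun=> 0) (fun _ _ _ => scaler0 _ _).
have phi_homo : {homo phi : x y / x <= y}.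
  by move=> v w _; rewrite [v]permpow_dim0 [w]permpow_dim0.
have gen0 i : permpow_gen D i <= (0 : permpow D 0) by case: i.
by exists (@Stage 0%N phi 0 (fun m c => enum 0%N c) phi_homo (lexx _) gen0).
Qed.

Hypothesis enumP : forall k (v : permpow D k), exists c, enum k c = v.
Hypothesis targetP : forall x : G, 0 <= x -> exists n, target n = x.

(** Iterating [next_stage] gives a sequence whose kernels die and whose images
    exhaust [G]: a positive element is reached by its turn as a target, and an
    arbitrary one is a difference of two positive ones because [G] is
    directed. *)
Lemma dimension_ultrasimplicial_interval :
  directed G -> ultrasimplicial_interval G.
Proof.
move=> dirG.
have /choice[nxt nxtP] (p : nat * stage) := next_stage_exists p.1 p.2.
have [s0 s0P] := initial_stage_exists.
pose s := fix s n := if n is n'.+1 then nxt (n', s n') else s0.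
have /all_sig[f fP] n := cid (nxtP (n, s n)).
have f_homo n : {homo f n : x y / x <= y} by have [[]] := fP n.
pose X n : intervalGroup gT :=
  IntervalGroup (permpow_interval (st_unit_ge0 (s n)) (@st_unit_gen (s n))).
pose L := IntervalGroup (positive_cone_interval dirG).
pose phi n : {linear X n -> L} := st_map (s n).
pose tr := transition (X := fun n => X n) f.
have phi_homo n : {homo phi n : x y / x <= y} := @st_homo (s n).
have phif n : phi n.+1 \o f n =1 phi n by have [[]] := fP n.
have pend_new n c : st_pending (s n) n c = enum (st_dim (s n)) c.
  case: n => [|n]; first exact: s0P.
  by have [_ _ _ ->] := fP n; rewrite eqxx.
have pend_tr n m c : (m <= n)%N ->
    st_pending (s n) m c = tr m n (enum (st_dim (s m)) c).
  elim: n => [|n IH].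
    by rewrite leqn0 => /eqP ->; rewrite pend_new /tr transition_id.
  rewrite leq_eqVlt => /orP[/eqP ->|].
    by rewrite pend_new /tr transition_id.
  rewrite ltnS => mn; rewrite /tr transitionS // -/tr -IH //.
  by have [_ _ _ ->] := fP n; rewrite ltn_eqF.
have reach l : 0 <= l -> exists n (x : X n), ig_interval x /\ phi n x = l.
  move=> /targetP[n <-]; have [_ _ [z zu zE] _] := fP n.
  by exists n.+1, z.
have limL : seq_limit (X := OSys f_homo) phi.
  split=> //.
  - by move=> l /reach[n [x [/andP[x0 _] xl]]]; exists n, x.
  - move=> l; have [p [q [/reach[n [x [_ xp]]] /reach[m [y [_ yq]]] ->]]] :=
      og_directed_split dirG l.
    have nk : (n <= maxn n m)%N by rewrite leq_maxl.
    have mk : (m <= maxn n m)%N by rewrite leq_maxr.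
    exists (maxn n m), (tr n _ x - tr m _ y).
    by rewrite raddfB /= !(transition_cocone phif) // xp yq.
  move=> m x phix; have [c cx] := enumP x.
  (* The stage whose step kills the image of the [c]-th element of [X m]. *)
  pose n := (2 ^ m * 3 ^ c)%N.
  have mn : (m <= n)%N.
    apply: leq_trans (ltnW (ltn_expl m (ltnSn 1))) _.
    by rewrite leq_pmulr // expn_gt0.
  have n2 : logn 2 n = m.
    by rewrite lognM ?expn_gt0 // !lognX /= muln1 muln0 addn0.
  have n3 : logn 3 n = c.
    by rewrite lognM ?expn_gt0 // !lognX /= muln1 muln0 add0n.
  exists n.+1; first exact: leqW.
  rewrite transitionS //; have [_ + _ _] := fP n; rewrite /= n2 n3.
  rewrite pend_tr // cx; apply.
  by rewrite -[LHS]/(phi n _) /tr (transition_cocone phif).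
exists [set x : G | 0 <= x]%classic, (positive_cone_interval dirG), D, X.
split=> [n|n|].
- exact: permpow_simplicial.
- exists (st_unit (s n)); split=> //.
  by apply: permpow_order_unit; [exact: st_unit_ge0 | exact: st_unit_gen].
apply: (@seq_limit_interval gT X L f f_homo phi limL) => // n x /andP[x0 xu].
  have [[_ _ fu] _ _ _] := fP n; apply/andP; split.
    exact: linear_homo_ge0 (f_homo n) _ x0.
  exact: le_trans (f_homo n _ _ xu) fu.
exact: linear_homo_ge0 (phi_homo n) _ x0.
Qed.

End Construction.

Lemma dimension_ultrasimplicial (gT : groupType)
    (abel : forall g h : gT, commute g h) (fg : finitely_generated gT)
    (G : ogrpType gT) :
  countable [set: G]%classic -> dimension_group G -> ultrasimplicial G.
Proof.
move=> /(countable_enumerated 0)[e eP] [dirG [D [D_stab sdp]]].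
split=> //; right.
have gT_enum := finitely_generated_enumerated fg.
have /all_sig[enum enumP] k :
    {e : nat -> permpow D k | forall v, exists c, e c = v}.
  apply/cid/(span_enumerated (x := @permpow_gen gT D k) gT_enum) => v.
  by eexists; exact: permpow_gen_span.
pose target n := if 0 <= e n then e n else 0.
apply: (@dimension_ultrasimplicial_interval gT abel G D D_stab sdp enum target)
  => // [n|x x0].
  by rewrite /target; case: ifP.
by have [n en] := eP x; exists n; rewrite /target en x0.
Qed.

Theorem corollary5p15 (gT : groupType)
    (abel : forall g h : gT, commute g h)
    (fg : finitely_generated gT) (G : ogrpType gT) :
  ultrasimplicial G <-> countable [set: G]%classic /\ dimension_group G.
Proof.
split=> [|[cG dG]]; first exact: ultrasimplicial_dimension.
exact: dimension_ultrasimplicial.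
Qed.
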